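(* Let $\Theta:C\setminus\{o\}\to(0,\infty)$ be continuous and positively homogeneous of degree $-q$, let $E$ be a $C$-pseudo-cone, let $\mathbb{A}$ be a $C$-asymptotic set and let $z\in C\setminus\{o\}$. Then: (a) if $q>n$: $\int_{\partial_eE}\Theta\,d\mathcal{H}^{n-1}<\infty$, $V_\Theta(E)<\infty$, $\overline{V}_\Theta(E)=+\infty$, $T_\Theta(\mathbb{A},o)=+\infty$, and $T_\Theta(\mathbb{A},z)<\infty$; (b) if $q=n$: $\int_{\partial_eE}\Theta\,d\mathcal{H}^{n-1}<\infty$, $V_\Theta(E)=+\infty$, $\overline{V}_\Theta(E)=+\infty$, $T_\Theta(\mathbb{A},o)=+\infty$, and $T_\Theta(\mathbb{A},z)<\infty$; (c) if $n-1<q<n$: $\int_{\partial_eE}\Theta\,d\mathcal{H}^{n-1}<\infty$, $V_\Theta(E)=+\infty$, $\overline{V}_\Theta(E)<\infty$, $T_\Theta(\mathbb{A},o)<\infty$, and $T_\Theta(\mathbb{A},z)<\infty$; (d) if $0\le q\le n-1$: $V_\Theta(E)=+\infty$.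
   Context: $C\subset\mathbb{R}^n$ ($n\ge2$) is a pointed closed convex cone with nonempty interior. A $C$-pseudo-cone is a nonempty closed convex set $E$ with $o\notin E$, $\lambda x\in E$ for all $x\in E,\lambda\ge1$, and recession cone $\{x:E+x\subset E\}$ equal to $C$. A $C$-asymptotic set is an unbounded closed convex set $\mathbb{A}\subset C$ with nonempty interior and $o\notin\mathbb{A}$ such that $\lim_{x\in\partial\mathbb{A},|x|\to\infty}d(x,\partial C)=0$. The weight $\Theta$ satisfies $\Theta(tx)=t^{-q}\Theta(x)$ for $t>0$. Weighted volume $V_\Theta(E)=\int_E\Theta\,d\mathcal{H}^n$; weighted co-volume $\overline{V}_\Theta(E)=\int_{C\setminus E}\Theta\,d\mathcal{H}^n$. For a $C$-asymptotic set $\mathbb{A}$ and $z\in C$, the asymptotic weighted co-volume is $T_\Theta(\mathbb{A},z)=\int_{(z+C)\setminus(z+\mathbb{A})}\Theta\,d\mathcal{H}^n$. The effective boundary is $\partial_eE=E\cap\operatorname{cl}(C\setminus E)$; $\int_{\partial_eE}\Theta\,d\mathcal{H}^{n-1}$ is the total mass of the weighted surface area measure of $E$. *)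

(* Defs.v *)
From HB Require Import structures.
From mathcomp Require Import all_boot all_order all_algebra.
From mathcomp Require Import all_classical all_reals all_analysis.
Set Implicit Arguments. Unset Strict Implicit. Unset Printing Implicit Defensive.
Import Order.TTheory GRing.Theory Num.Theory.
Import numFieldNormedType.Exports.
Local Open Scope classical_set_scope.
Local Open Scope ring_scope.

(* Euclidean norm |x| on R^n (the matrix library's own norm is the max-norm). *)
Definition enorm (R : realType) (n : nat) (x : 'rV[R]_n) : R :=
  Num.sqrt (\sum_(i < n) (x ord0 i) ^+ 2).

(* Euclidean diameter of a set, in \bar R (-oo for the empty set). *)
Definition ediam (R : realType) (n : nat) (U : set 'rV[R]_n) : \bar R :=
  ereal_sup [set r | exists x y, U x /\ U y /\ r = (enorm (x - y))%:E].

Fixpoint unit_ball_vol (R : realType) (k : nat) : R :=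
  match k with
  | 0%N => 1
  | 1%N => 2
  | (j.+2)%N => (2 * pi / (j.+2)%:R) * unit_ball_vol R j
  end.

Definition haus_const (R : realType) (k : nat) : R :=
  unit_ball_vol R k / 2 ^+ k.

Definition haus_piece (R : realType) (n k : nat) (U : set 'rV[R]_n) : \bar R :=
  if `[< U = set0 >] then 0%E
  else (haus_const R k * (fine (ediam U)) ^+ k)%:E.

Definition haus_delta (R : realType) (n k : nat) (d : R) (A : set 'rV[R]_n)
  : \bar R :=
  ereal_inf [set s | exists U : (set 'rV[R]_n)^nat,
     A `<=` \bigcup_i U i /\ (forall i, (ediam (U i) <= d%:E)%E) /\
     s = (\sum_(0 <= i <oo) haus_piece k (U i))%E].

Definition hausdorff (R : realType) (n k : nat) (A : set 'rV[R]_n) : \bar R :=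
  ereal_sup [set haus_delta k d A | d in [set d : R | 0 < d]].

(* Integral of a nonnegative weight Theta over A with respect to H^k,
   via the layer-cake formula  int_A Theta dH^k = int_0^oo H^k(A /\ {Theta > t}) dt. *)
Definition haus_wint (R : realType) (n k : nat) (Theta : 'rV[R]_n -> R)
  (A : set 'rV[R]_n) : \bar R :=
  (\int[@lebesgue_measure R]_(t in [set t : R | (0 < t)%R])
     hausdorff k [set x | A x /\ (t < Theta x)%R])%E.

Definition convex_set (R : realType) (n : nat) (A : set 'rV[R]_n) : Prop :=
  forall x y t, A x -> A y -> 0 <= t <= 1 -> A ((1 - t) *: x + t *: y).

Definition pointed_cone (R : realType) (n : nat) (C : set 'rV[R]_n) : Prop :=
  [/\ C 0, (forall x l, C x -> 0 <= l -> C (l *: x)),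
      (forall x y, C x -> C y -> C (x + y)), convex_set C &
      [/\ closed C, (forall x, C x -> C (- x) -> x = 0) & interior C !=set0]].

Definition recession_cone (R : realType) (n : nat) (E : set 'rV[R]_n)
  : set 'rV[R]_n := [set x | forall y, E y -> E (y + x)].

Definition pseudo_cone (R : realType) (n : nat) (C E : set 'rV[R]_n) : Prop :=
  [/\ E !=set0, closed E, convex_set E, ~ E 0 &
      [/\ (forall x l, E x -> 1 <= l -> E (l *: x)) & recession_cone E = C]].

Definition bd (R : realType) (n : nat) (A : set 'rV[R]_n) : set 'rV[R]_n :=
  closure A `\` interior A.

Definition edist (R : realType) (n : nat) (x : 'rV[R]_n) (S : set 'rV[R]_n)
  : \bar R := ereal_inf [set (enorm (x - y))%:E | y in S].

Definition asymptotic_set (R : realType) (n : nat) (C A : set 'rV[R]_n) : Prop :=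
  [/\ ~ (exists M : R, forall x, A x -> enorm x <= M),
      closed A, convex_set A, A `<=` C &
      [/\ interior A !=set0, ~ A 0 &
      forall e : R, 0 < e -> exists M : R, forall x, bd A x -> M < enorm x ->
        (edist x (bd C) < e%:E)%E]].

Definition eff_bd (R : realType) (n : nat) (C E : set 'rV[R]_n) : set 'rV[R]_n :=
  E `&` closure (C `\` E).

Definition translate (R : realType) (n : nat) (z : 'rV[R]_n) (S : set 'rV[R]_n)
  : set 'rV[R]_n := [set z + y | y in S].

Definition wvol (R : realType) (n : nat) Theta (E : set 'rV[R]_n) : \bar R :=
  haus_wint n Theta E.
Definition wcovol (R : realType) (n : nat) Theta (C E : set 'rV[R]_n) : \bar R :=
  haus_wint n Theta (C `\` E).
Definition asym_covol (R : realType) (n : nat) Theta (C A : set 'rV[R]_n)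
  (z : 'rV[R]_n) : \bar R :=
  haus_wint n Theta (translate z C `\` translate z A).
Definition wsurf (R : realType) (n : nat) Theta (C E : set 'rV[R]_n) : \bar R :=
  haus_wint n.-1 Theta (eff_bd C E).

Definition admissible_weight (R : realType) (n : nat) (C : set 'rV[R]_n)
  (q : R) (Theta : 'rV[R]_n -> R) : Prop :=
  [/\ {within C `\ 0, continuous Theta},
      (forall x, (C `\ 0) x -> 0 < Theta x) &
      (forall x t, (C `\ 0) x -> 0 < t -> Theta (t *: x) = powR t (- q) * Theta x)].

(* Main.v *)
Require Import Defs.
From HB Require Import structures.
From mathcomp Require Import all_boot all_order all_algebra finmap.
From mathcomp Require Import all_classical all_reals all_analysis.
From mathcomp Require Import measurable_realfun ring lra zify.
Import Order.TTheory GRing.Theory Num.Theory.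
Import numFieldNormedType.Exports.
Set Implicit Arguments. Unset Strict Implicit. Unset Printing Implicit Defensive.
Local Open Scope classical_set_scope.
Local Open Scope ring_scope.

(* Homogeneity gives Theta x <= M |x|^(-q) on C, so {Theta > t} lies in the
   ball of radius rho(t) = (M / t)^(1/q), and on a cone over a small ball the
   reverse estimate holds.  Up to constants all integrals therefore reduce to
   the growth in r of Hausdorff measures of sets intersected with balls of
   radius r, followed by comparison of the layer-cake integrand with powers
   of t.

   Along an interior direction e of C, the effective boundary of E is a
   Lipschitz graph over a hyperplane (the difference of two of its points is
   never in int C), whence growth r^(n-1).  Both E and A contain a translate
   w + C; C \ (w + C) meets each line of direction e in a segment of bounded
   length, whence again growth r^(n-1), up to the bounded scale.  For A such a
   translate exists because, a being interior to A, all points of a/2 + C are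
   uniformly far from bd C, so bd A meets a/2 + C in a bounded set only.

   Lower bounds for the n-dimensional Hausdorff measure of a cube come from a
   finite subcover by balls and from counting the points of a fine grid. *)

(** * Hausdorff measure *)

Section Hausdorff.
Context {R : realType}.

Lemma haus_const_gt0 k : 0 < haus_const R k.
Proof.
rewrite divr_gt0 ?exprn_gt0//.
(* The recursion descends by two, so two consecutive values are carried along. *)
suff : 0 < unit_ball_vol R k /\ 0 < unit_ball_vol R k.+1 by case.
elim: k => [|k [IH1 IH2]]; first by rewrite /= !ltr0n.
by split=> //; rewrite /= mulr_gt0// divr_gt0 ?ltr0n// mulr_gt0 ?ltr0n ?pi_gt0.
Qed.

Lemma coord_le_norm {m} (x : 'rV[R]_m) i : `|x ord0 i| <= `|x|.
Proof.
rewrite [leRHS]mx_normrE; exact: (le_bigmax _ (fun ij : 'I_1 * 'I_m => `|x ij.1 ij.2|) (ord0, i)).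
Qed.

Lemma norm_le_coord {m} (x : 'rV[R]_m) r :
  0 <= r -> (forall i, `|x ord0 i| <= r) -> `|x| <= r.
Proof.
move=> r0 h; rewrite [leLHS]mx_normrE; apply/bigmax_leP; split=> // -[i j] _ /=.
by rewrite (ord1 i).
Qed.

Lemma enorm_le {m} (x : 'rV[R]_m) : enorm x <= m%:R * `|x|.
Proof.
have m0 : 0 <= m%:R * `|x| by rewrite mulr_ge0.
rewrite -[leRHS]ger0_norm// -sqrtr_sqr ler_sqrt ?sqr_ge0//.
apply: (@le_trans _ _ (\sum_(i < m) `|x| ^+ 2)).
  apply: ler_sum => i _; rewrite -[leLHS]real_normK ?num_real//.
  by rewrite lerXn2r ?nnegrE ?coord_le_norm.
rewrite sumr_const card_ord exprMn -[leLHS]mulr_natl ler_wpM2r ?sqr_ge0//.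
by case: (m) => [|k]; rewrite ?expr0n// -natrX ler_nat; lia.
Qed.

Lemma norm_le_enorm {m} (x : 'rV[R]_m) : `|x| <= enorm x.
Proof.
apply: norm_le_coord => [|i]; first exact: sqrtr_ge0.
rewrite -sqrtr_sqr ler_sqrt ?sumr_ge0// => [|j _]; last exact: sqr_ge0.
by rewrite (bigD1 i)//= lerDl sumr_ge0// => j _; exact: sqr_ge0.
Qed.

Lemma ediam_le {m} (U : set 'rV[R]_m) D :
  (forall x y, U x -> U y -> `|x - y| <= D) -> (ediam U <= (m%:R * D)%:E)%E.
Proof.
move=> UD; apply: ge_ereal_sup => _ [x [y [Ux [Uy ->]]]].
rewrite lee_fin (le_trans (enorm_le _))// ler_wpM2l//; exact: UD.
Qed.

Lemma ediam_ge {m} (U : set 'rV[R]_m) x y :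
  U x -> U y -> (`|x - y|%:E <= ediam U)%E.
Proof.
move=> Ux Uy; apply: (@le_trans _ _ (enorm (x - y))%:E).
  by rewrite lee_fin norm_le_enorm.
by apply: ereal_sup_ubound; exists x, y.
Qed.

Lemma ediam_ge0 {m} (U : set 'rV[R]_m) : U !=set0 -> (0 <= ediam U)%E.
Proof. by case=> x Ux; have := ediam_ge Ux Ux; rewrite subrr normr0. Qed.

Lemma ediam0 {m} : ediam (@set0 'rV[R]_m) = -oo%E.
Proof.
by apply/eqP; rewrite -leeNy_eq; apply: ge_ereal_sup => r [? [? []]].
Qed.

Lemma haus_piece_ge0 {m} k (U : set 'rV[R]_m) : (0 <= haus_piece k U)%E.
Proof.
rewrite /haus_piece; case: asboolP => // /eqP/set0P U0.
by rewrite lee_fin mulr_ge0 ?(ltW (haus_const_gt0 _))// exprn_ge0// fine_ge0// ediam_ge0.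
Qed.

Lemma haus_piece_le {m} k (U : set 'rV[R]_m) D : 0 <= D ->
  (ediam U <= D%:E)%E -> (haus_piece k U <= (haus_const R k * D ^+ k)%:E)%E.
Proof.
move=> D0 UD; rewrite /haus_piece; case: asboolP => [_|/eqP/set0P U0].
  by rewrite lee_fin mulr_ge0 ?(ltW (haus_const_gt0 _))// exprn_ge0.
have d0 := ediam_ge0 U0.
have fU : ediam U \is a fin_num.
  by rewrite ge0_fin_numE// (le_lt_trans UD) ?ltry.
rewrite lee_fin ler_wpM2l ?(ltW (haus_const_gt0 _))//.
by rewrite lerXn2r ?nnegrE ?fine_ge0// -lee_fin fineK.
Qed.

(** At each scale the cells have one common size [D], so an upper bound comes down to counting
    them. *)
Lemma hausdorff_finite_cover {m} k (S : set 'rV[R]_m) B :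
  (forall d, 0 < d -> exists (I : finType) (U : I -> set 'rV[R]_m) (D : R),
     [/\ 0 <= D, D <= d, S `<=` \bigcup_i U i,
         (forall i, (ediam (U i) <= D%:E)%E) & #|I|%:R * D ^+ k <= B]) ->
  (hausdorff k S <= (haus_const R k * B)%:E)%E.
Proof.
move=> H; apply: ge_ereal_sup => _ [d /= d0 <-].
have [I [U [D [D0 Dd SU UD IB]]]] := H _ d0.
(* The sequence enumerates [I] and is then padded with the empty set, of diameter [-oo] and zero
   cost. *)
pose V i := oapp U set0 (omap enum_val (insub i : option 'I_#|I|)).
have VN i : (#|I| <= i)%N -> V i = set0.
  by move=> Ni; rewrite /V insubF // ltnNge Ni.
have Vd i : (ediam (V i) <= D%:E)%E.
  rewrite /V; case: insub => [j|] /=; first exact: UD.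
  by rewrite ediam0 leNye.
apply: (@le_trans _ _ (\sum_(0 <= i <oo) haus_piece k (V i))%E).
  apply: ereal_inf_lbound; exists V; split; last by split=> // i; rewrite (le_trans (Vd i)) ?lee_fin.
  move=> x /SU[i _ Ux]; exists (enum_rank i) => //.
  by rewrite /V insubT //= => p; rewrite (_ : Sub _ _ = enum_rank i) ?enum_rankK//; exact: val_inj.
rewrite (@nneseries_split _ _ 0 #|I|) ?add0n; last by move=> *; exact: haus_piece_ge0.
rewrite [X in (_ + X)%E]eseries0 ?adde0; last first.
  by move=> i Ni _; rewrite /haus_piece VN// asboolT.
apply: (@le_trans _ _ (\sum_(0 <= i < #|I|) (haus_const R k * D ^+ k)%:E)%E).
  by apply: lee_sum => i _; exact: haus_piece_le.
rewrite big_mkord sumEFin lee_fin sumr_const card_ord -[leLHS]mulr_natl mulrCA ler_wpM2l//.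
exact: ltW (haus_const_gt0 _).
Qed.

End Hausdorff.

(** * Upper bounds on Hausdorff measures by grids *)

Section HausdorffUpper.
Context {R : realType}.

(** Cells are given by labels. Each coordinate takes [N.+1] of them because truncation sends the
    right endpoint [r] to the index [N]. *)
Lemma grid_cells m (r : R) N : 0 < r -> (0 < N)%N ->
  exists c : 'rV[R]_m -> {ffun 'I_m -> 'I_N.+1}, forall v w,
    `|v| <= r -> `|w| <= r -> c v = c w -> `|v - w| <= 2 * r / N%:R.
Proof.
move=> r0 N0; have N0' : 0 < N%:R :> R by rewrite ltr0n.
pose h := 2 * r / N%:R; have h0 : 0 < h by rewrite divr_gt0 ?mulr_gt0.
exists (fun v => [ffun i => inord (Num.truncn ((v ord0 i + r) / h))]) => v w vr wr /ffunP cvw.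
apply: norm_le_coord => [|i]; first exact: ltW.
have bd (u : 'rV[R]_m) : `|u| <= r -> 0 <= (u ord0 i + r) / h /\ (Num.truncn ((u ord0 i + r) / h) < N.+1)%N.
  move=> ur; have : `|u ord0 i| <= r by rewrite (le_trans (coord_le_norm _ _)).
  rewrite ler_norml => /andP[u1 u2]; have u0 : 0 <= (u ord0 i + r) / h.
    by rewrite divr_ge0 ?(ltW h0)//; lra.
  split=> //; rewrite truncn_lt_nat// ltr_pdivrMr// /h.
  have -> : N.+1%:R * (2 * r / N%:R) = 2 * r + 2 * r / N%:R.
    by rewrite -natr1; field; rewrite lt0r_neq0.
  by rewrite -/h; lra.
have [v0 vN] := bd _ vr; have [w0 wN] := bd _ wr.
have := congr1 (@nat_of_ord _) (cvw i); rewrite !ffunE !inordK// => e.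
have := truncn_itv v0; have := truncn_itv w0; rewrite e.
set t := (Num.truncn _)%:R; rewrite -natr1 -/t => /andP[w1 w2] /andP[v1 v2].
have {w1 w2 v1 v2} : `|(v ord0 i + r) / h - (w ord0 i + r) / h| <= 1.
  by rewrite ler_norml; apply/andP; split; lra.
rewrite -mulrBl normrM normfV (gtr0_norm h0) ler_pdivrMr// mul1r !mxE.
by rewrite (_ : v ord0 i + r - _ = v ord0 i - w ord0 i)//; ring.
Qed.

Lemma succ_ratio (N : nat) (c : R) : (0 < N)%N -> 0 <= c -> N.+1%:R * (c / N%:R) <= 2 * c.
Proof.
move=> N0 c0; have N0' : 1 <= N%:R :> R by rewrite ler1n.
rewrite mulrCA mulrC ler_wpM2r// ler_pdivrMr ?(lt_le_trans _ N0')//.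
by rewrite -natr1; lra.
Qed.

Lemma fine_mesh (c d : R) : 0 < d -> exists2 N : nat, (0 < N)%N & c / N%:R <= d.
Proof.
move=> d0; exists (Num.truncn (c / d)).+1 => //.
rewrite ler_pdivrMr ?ltr0n// mulrC -ler_pdivrMr//.
exact/ltW/truncnS_gt.
Qed.

(** The grid on the ball of radius [r] in the target pulls back along [p] to at most [N.+1 ^ m]
    cells of size proportional to [1 / N], so the [m]-dimensional cost is bounded independently of
    [N]. *)
Lemma hausdorff_lipschitz n m (S : set 'rV[R]_n) (p : 'rV[R]_n -> 'rV[R]_m) L r :
  0 <= L -> 0 < r ->
  (forall x, S x -> `|p x| <= r) ->
  (forall x y, S x -> S y -> `|x - y| <= L * `|p x - p y|) ->
  (hausdorff m S <= (haus_const R m * (4 * n%:R * L * r) ^+ m)%:E)%E.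
Proof.
move=> L0 r0 pr pL; apply: hausdorff_finite_cover => d d0.
have [N N0 Nd] := fine_mesh (n%:R * (L * (2 * r))) d0.
have [c cP] := grid_cells m r0 N0.
exists {ffun 'I_m -> 'I_N.+1}, (fun f => [set x | S x /\ c (p x) = f]),
  (n%:R * (L * (2 * r)) / N%:R).
have c0 : 0 <= n%:R * (L * (2 * r)) by rewrite !mulr_ge0 ?(ltW r0).
split=> //.
- by rewrite divr_ge0.
- by move=> x Sx; exists (c (p x)).
- move=> f; rewrite -!mulrA; apply: ediam_le => x y [Sx <-] [Sy /esym cxy].
  rewrite (le_trans (pL _ _ Sx Sy))// ler_wpM2l// mulrA.
  by apply: cP => //; exact: pr.
- rewrite card_ffun !card_ord natrX -exprMn lerXn2r ?nnegrE ?mulr_ge0 ?invr_ge0 ?(ltW r0)//.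
  by rewrite (le_trans (succ_ratio N0 c0))//; lra.
Qed.

(** A coarse grid of mesh at most 1 on the image of [p] cuts [S] into at most [(2 * (r + 1)) ^+ m]
    pieces of diameter at most [2 * L]. A fine grid of the ambient space then covers each piece at
    an [n]-dimensional cost bounded independently of its mesh. *)
Lemma hausdorff_slab n m (S : set 'rV[R]_n) (p : 'rV[R]_n -> 'rV[R]_m) L r :
  0 < L -> 0 < r ->
  (forall x, S x -> `|p x| <= r) ->
  (forall x y, S x -> S y -> `|x - y| <= L * (1 + `|p x - p y|)) ->
  (hausdorff n S <=
   (haus_const R n * ((8 * n%:R * L) ^+ n * (2 * (r + 1)) ^+ m))%:E)%E.
Proof.
move=> L0 r0 pr pL; apply: hausdorff_finite_cover => d d0.
have [N N0 Nd] := fine_mesh (n%:R * (4 * L)) d0.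
pose P := (Num.truncn (2 * r)).+1.
have [cp cpP] := grid_cells m r0 (ltn0Sn _ : 0 < P)%N.
have [cn cnP] := grid_cells n (mulr_gt0 (ltr0n _ 2) L0) N0.
pose cell f := [set x | S x /\ cp (p x) = f].
(* Base point of a coarse cell; the default matters only for empty cells. *)
pose b f := xget 0 (cell f).
have close x y : S x -> S y -> cp (p x) = cp (p y) -> `|x - y| <= 2 * L.
  move=> Sx Sy e; rewrite (le_trans (pL _ _ Sx Sy))// mulrC ler_wpM2r ?(ltW L0)//.
  have := cpP _ _ (pr _ Sx) (pr _ Sy) e.
  suff : 2 * r / P%:R <= 1 by lra.
  by rewrite ler_pdivrMr ?ltr0n// mul1r ltW// truncnS_gt.
have bP x f : cell f x -> `|x - b f| <= 2 * L.
  by move=> cx; have [Sb cb] := xgetPex 0 (ex_intro _ _ cx); case: cx => Sx cx; apply: close; rewrite // cx.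
exists ({ffun 'I_m -> 'I_P.+1} * {ffun 'I_n -> 'I_N.+1})%type,
  (fun f => [set x | cell f.1 x /\ cn (x - b f.1) = f.2]), (n%:R * (4 * L) / N%:R).
have c0 : 0 <= n%:R * (4 * L) by rewrite !mulr_ge0 ?(ltW L0).
split=> //.
- by rewrite divr_ge0.
- by move=> x Sx; exists (cp (p x), cn (x - b (cp (p x)))).
- move=> [f g] /=; rewrite -!mulrA; apply: ediam_le => x y [fx gx] [fy gy].
  have -> : x - y = (x - b f) - (y - b f) by rewrite opprB addrA subrK.
  have -> : 4 * (L / N%:R) = 2 * (2 * L) / N%:R by ring.
  by apply: cnP; rewrite ?bP// gx.
- rewrite card_prod natrM !card_ffun !card_ord !natrX -mulrA mulrC -exprMn.
  apply: ler_pM; rewrite ?exprn_ge0//.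
  + by rewrite mulr_ge0// divr_ge0.
  + rewrite lerXn2r ?nnegrE ?mulr_ge0 ?invr_ge0 ?(ltW L0)//.
    by rewrite (le_trans (succ_ratio N0 c0))//; lra.
  + rewrite lerXn2r ?nnegrE ?ler0n ?mulr_ge0 ?addr_ge0 ?(ltW r0)//.
    have : (Num.truncn (2 * r))%:R <= 2 * r by rewrite truncn_le mulr_ge0// ltW.
    by rewrite /P -[_.+2%:R]natr1 -[_.+1%:R]natr1; lra.
Qed.

End HausdorffUpper.

(** * Lower bound on the [n]-dimensional measure of a cube *)

Section HausdorffLower.
Context {R : realType}.

(** An open interval of length [2 * rho] contains at most [2 * rho / h + 1] multiples of [h], and
    [h <= rho] absorbs the extra 1. *)
Lemma card_ord_close N (h c rho : R) : 0 < h -> h <= rho ->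
  #|[pred j : 'I_N | `|j%:R * h - c| < rho]|%:R <= 3 * rho / h.
Proof.
move=> h0 hr; set P := [pred j | _].
have r1 : 1 <= rho / h by rewrite ler_pdivlMr// mul1r.
have [i0 Pi0|P0] := pickP P; last first.
  by rewrite (eq_card0 P0) -mulrA; lra.
(* All indices in the interval lie within [k] of the least one [j0], so subtracting [j0] injects
   them into ['I_k.+1]. *)
case: (arg_minnP (fun j : 'I_N => val j) Pi0) => j0 Pj0 jmin.
pose k := Num.truncn (2 * rho / h).
have jk j : P j -> (j - j0 < k.+1)%N.
  move=> Pj; have jj := jmin _ Pj; rewrite ltnS /k truncn_ge_nat; last first.
    by rewrite -mulrA; lra.
  rewrite natrB// ler_pdivlMr// mulrBl.
  move: Pj Pj0; rewrite /P !inE !ltr_norml => /andP[? ?] /andP[? ?]; lra.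
have inj : {in P &, injective (fun j : 'I_N => inord (j - j0) : 'I_k.+1)}.
  move=> i j Pi Pj /(congr1 (@nat_of_ord _)); rewrite !inordK ?jk// => e.
  by apply/val_inj => /=; have := jmin _ Pi; have := jmin _ Pj => /=; lia.
rewrite -(card_in_image inj); apply: (@le_trans _ _ k.+1%:R).
  by rewrite ler_nat -[leqRHS](card_ord k.+1) max_card.
have : k%:R <= 2 * rho / h by rewrite truncn_le -mulrA; lra.
by rewrite -natr1 -!mulrA; lra.
Qed.

(** A volume comparison by counting: [N ^ n] grid points lie in the cube, each is caught by some
    ball, and ball [i] holds at most [(3 * rho i / h) ^+ n] of them. It remains to multiply by
    [h ^+ n]. *)
Lemma ball_cover_volume n (x : 'rV[R]_n) s M (y : nat -> 'rV[R]_n) (rho : nat -> R) :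
  0 < s -> (forall i, 0 < rho i) ->
  (forall v, `|v - x| <= s -> exists2 i, (i < M)%N & `|v - y i| < rho i) ->
  (2 * s) ^+ n <= \sum_(i < M) (3 * rho i) ^+ n.
Proof.
move=> s0 rho0 cov.
(* One mesh below all of the finitely many radii. *)
have [N N0 Nrho] : exists2 N, (0 < N)%N & forall i, (i < M)%N -> 2 * s / N%:R <= rho i.
  elim: M {cov} => [|M [N N0 IH]]; first by exists 1%N.
  have [N' N0' h'] := fine_mesh (2 * s) (rho0 M).
  exists (maxn N N') => [|i]; first by rewrite leq_max N0.
  have mono (k : nat) : (0 < k)%N -> (k <= maxn N N')%N -> 2 * s / (maxn N N')%:R <= 2 * s / k%:R.
    move=> k0 kN; rewrite ler_pM2l ?mulr_gt0// lef_pV2 ?posrE ?ltr0n ?ler_nat//.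
    exact: leq_trans kN.
  rewrite ltnS leq_eqVlt => /orP[/eqP ->|/IH]; [apply: le_trans h'|apply: le_trans]; apply: mono => //.
    exact: leq_maxr.
  exact: leq_maxl.
have NR0 : 0 < N%:R :> R by rewrite ltr0n.
set h := 2 * s / N%:R in Nrho.
have h0 : 0 < h by rewrite divr_gt0 ?mulr_gt0.
pose g (f : {ffun 'I_n -> 'I_N}) : 'rV[R]_n := \row_j (x ord0 j - s + (f j)%:R * h).
pose A (i : 'I_M) := family (fun j : 'I_n => [pred k : 'I_N | `|k%:R * h - (y i ord0 j - x ord0 j + s)| < rho i]).
have cardA : (N ^ n <= \sum_(i < M) #|A i|)%N.
  rewrite -[X in (X ^ _)%N]card_ord -[X in (_ ^ X)%N](card_ord n) -card_ffun -sum1_card.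
  under [leqRHS]eq_bigr do rewrite -sum1_card big_mkcond/=.
  rewrite exchange_big/=; apply: leq_sum => f _.
  have [|i iM gi] := cov (g f).
    apply: norm_le_coord => [|j]; first exact: ltW.
    rewrite !mxE (_ : _ - _ = (f j)%:R * h - s); last by ring.
    have : 0 <= (f j)%:R * h by rewrite mulr_ge0// ltW.
    have : (f j)%:R * h <= 2 * s.
      by rewrite /h mulrCA ler_piMr ?mulr_ge0 ?(ltW s0)// ler_pdivrMr// mul1r ler_nat ltnW.
    by rewrite ler_norml; move=> ? ?; apply/andP; split; lra.
  rewrite (bigD1 (Ordinal iM))//= ifT//.
  apply/familyP => j; rewrite inE (le_lt_trans _ gi)//.
  apply: le_trans (coord_le_norm _ j); rewrite !mxE le_eqVlt; apply/orP; left.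
  by apply/eqP; congr (`| _ |); ring.
have hn0 : 0 < h ^+ n by rewrite exprn_gt0.
have -> : (2 * s) ^+ n = N%:R ^+ n * h ^+ n by rewrite -exprMn /h [N%:R * _]mulrC divfK// gt_eqF.
rewrite -ler_pdivlMr// -natrX (le_trans (_ : _ <= (\sum_(i < M) #|A i|)%:R))// ?ler_nat//.
rewrite natr_sum mulr_suml; apply: ler_sum => i _.
rewrite -expr_div_n card_family.
rewrite -[X in _ <= _ ^+ X](size_enum_ord n) /image_mem; elim: (enum _) => [|j e IH] /=; first by rewrite expr0.
rewrite natrM exprS ler_pM// card_ord_close//.
exact: Nrho.
Qed.

Lemma exprDn_le (a b : R) n : 0 <= a -> 0 <= b -> (a + b) ^+ n <= 2 ^+ n * (a ^+ n + b ^+ n).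
Proof.
move=> a0 b0; wlog ab : a b a0 b0 / a <= b.
  by move=> H; case: (leP a b) => [/H->//|/ltW/H]; rewrite addrC [b ^+ n + _]addrC; apply.
apply: (@le_trans _ _ ((2 * b) ^+ n)).
  by rewrite lerXn2r ?nnegrE ?addr_ge0 ?mulr_ge0//; lra.
by rewrite exprMn ler_pM2l ?exprn_gt0// lerDr exprn_ge0.
Qed.

(** The sets of a cover are replaced by slightly larger open balls, a finite subcover of the compact
    cube is extracted, and grid points are counted. The single scale 1 suffices, since the measure
    is a supremum over scales. *)
Lemma hausdorff_ball_ge n (S : set 'rV[R]_n) x s : (0 < n)%N -> 0 < s ->
  (forall v, `|v - x| <= s -> S v) ->
  ((haus_const R n * (s ^+ n / (2 * 3 ^+ n)))%:E <= hausdorff n S)%E.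
Proof.
move=> n0 s0 xS; apply: (@le_trans _ _ (haus_delta n 1 S)); last first.
  by apply: ereal_sup_ubound; exists 1 => //=.
apply: le_ereal_inf_tmp => _ [U [SU [U1 ->]]].
pose D i := fine (ediam (U i)).
have D0 i : 0 <= D i.
  have [/eqP Ui|/set0P Ui] := boolP (U i == set0); last exact/fine_ge0/ediam_ge0.
  by rewrite /D Ui ediam0.
(* An empty [U i] fits the formula because [fine] sends [-oo] to 0 and [0 ^+ n = 0] for positive
   [n]. *)
have pieceE i : haus_piece n (U i) = (haus_const R n * D i ^+ n)%:E.
  rewrite /haus_piece; case: asboolP => // Ui.
  by rewrite /D Ui ediam0 expr0n gtn_eqF ?mulr0.
(* The second bound lets the enlargement of the radii consume at most half of [(2 * s) ^+ n]; the
   first gives [eta i <= 1], hence [eta i ^+ n <= eta i]. *)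
pose e := Num.min 1 ((2 * s) ^+ n / (2 * 6 ^+ n)).
have e0 : 0 < e by rewrite lt_min ltr01 divr_gt0 ?mulr_gt0 ?exprn_gt0 ?mulr_gt0.
pose eta (i : nat) := e / (2 ^ (i + 1))%:R : R.
have eta0 i : 0 < eta i by rewrite divr_gt0// ltr0n expn_gt0.
pose y i := xget 0 (U i).
pose rho i := D i + eta i.
have rho0 i : 0 < rho i by rewrite ltr_wpDl.
have Urho i v : U i v -> `|v - y i| < rho i.
  move=> Uv; rewrite /rho; apply: (@le_lt_trans _ _ (D i)); last by rewrite ltrDl.
  rewrite -lee_fin fineK; last first.
    rewrite ge0_fin_numE; last by apply: ediam_ge0; exists v.
    by rewrite (le_lt_trans (U1 i)) ?ltry.
  by apply: ediam_ge => //; exact: xgetPex (ex_intro _ _ Uv).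
pose K := [set v : 'rV[R]_n | forall j, `[x ord0 j - s, x ord0 j + s]%classic (v ord0 j)].
have Kx v : K v -> `|v - x| <= s.
  move=> Kv; apply: norm_le_coord => [|j]; first exact: ltW.
  have := Kv j; rewrite /= in_itv/= !mxE ler_norml => /andP[? ?]; apply/andP; split; lra.
have Kc : compact K.
  apply: (@rV_compact _ n (fun j => `[x ord0 j - s, x ord0 j + s]%classic)) => j.
  exact: segment_compact.
have := Kc; rewrite compact_cover => /(_ nat setT (fun i => ball (y i) (rho i))).
case=> [i _|v Kv|F _ KF].
- exact: ball_open.
- by have [i _ Ui] := SU _ (xS _ (Kx _ Kv)); exists i => //; rewrite -ball_normE /= distrC; exact: Urho.
pose M := (\max_(i <- enum_fset F) i).+1.
have vol : (2 * s) ^+ n <= \sum_(i < M) (3 * rho i) ^+ n.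
  apply: (@ball_cover_volume n x s M y rho) => // v vx.
  have [|i Fi] := KF v.
    move=> j; have := le_trans (coord_le_norm _ j) vx.
    by rewrite !mxE ler_norml /= in_itv/= => /andP[? ?]; apply/andP; split; lra.
  rewrite -ball_normE /= distrC => yi; exists i => //.
  by rewrite ltnS; apply: leq_bigmax_seq.
have {vol} vol : (2 * s) ^+ n <= 6 ^+ n * (\sum_(i < M) D i ^+ n + e).
  apply: (le_trans vol); apply: (@le_trans _ _ (\sum_(i < M) 6 ^+ n * (D i ^+ n + eta i))).
    apply: ler_sum => i _; rewrite exprMn (_ : 6 = 3 * 2) ?[(3 * 2) ^+ _]exprMn -?mulrA; last by ring.
    rewrite ler_pM2l ?exprn_gt0// (le_trans (exprDn_le _ _ _))// ?(ltW (eta0 _))//.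
    rewrite ler_pM2l ?exprn_gt0// lerD2l -[leRHS]expr1 ler_wiXn2l ?(ltW (eta0 _))//.
    rewrite ler_pdivrMr ?ltr0n ?expn_gt0// mul1r (@le_trans _ _ 1)//.
      by rewrite ge_min lexx.
    by rewrite ler1n expn_gt0.
  rewrite -mulr_sumr ler_pM2l ?exprn_gt0// big_split lerD2l.
  have := @nneseries_lim_ge R (fun i => (eta i)%:E) xpredT 0%N M.
  rewrite big_mkord sumEFin -lee_fin => /(_ _)/le_trans; apply.
    by move=> *; rewrite lee_fin ltW.
  have := @cvg_geometric_eseries_half R e 0%N.
  by rewrite expr0 divr1 => /cvg_lim ->.
apply: le_trans (nneseries_lim_ge M _); last by move=> *; exact: haus_piece_ge0.
rewrite big_mkord; under eq_bigr do rewrite pieceE.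
rewrite sumEFin lee_fin -mulr_sumr.
rewrite ler_pM2l ?haus_const_gt0//.
have e6 : 6 ^+ n * e <= (2 * s) ^+ n / 2.
  apply: (@le_trans _ _ (6 ^+ n * ((2 * s) ^+ n / (2 * 6 ^+ n)))).
    by rewrite ler_pM2l ?exprn_gt0// ge_min lexx orbT.
  by rewrite le_eqVlt; apply/orP; left; apply/eqP; field; rewrite expf_neq0.
rewrite -(ler_pM2l (_ : 0 < 6 ^+ n)) ?exprn_gt0//.
have -> : 6 ^+ n * (s ^+ n / (2 * 3 ^+ n)) = (2 * s) ^+ n / 2.
  rewrite (_ : 6 = 2 * 3) ?exprMn; last by ring.
  by field; rewrite expf_neq0.
by move: vol; rewrite mulrDr; lra.
Qed.

End HausdorffLower.

(** * Layer-cake integrals of power-like functions *)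

Section Integrals.
Context {R : realType}.
Notation mu := (@lebesgue_measure R).

Lemma measurable_gt0 : measurable [set t : R | (0 < t)%R].
Proof.
rewrite (_ : mkset _ = `]0, +oo[%classic)//.
by apply/seteqP; split=> x /=; rewrite in_itv/= andbT.
Qed.

Lemma measurable_ge1 : measurable [set t : R | (1 <= t)%R].
Proof.
rewrite (_ : mkset _ = `[1, +oo[%classic)//.
by apply/seteqP; split=> x /=; rewrite in_itv/= andbT.
Qed.

Lemma measurable_gt0_le1 : measurable [set t : R | (0 < t <= 1)%R].
Proof.
by rewrite (_ : mkset _ = `]0, 1]%classic)//; apply/seteqP; split=> x /=; rewrite in_itv.
Qed.

(* Unlike the library's ge0_le_integral, no measurability is assumed, since
   none is available for t |-> H^k(A /\ {Theta > t}). *)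
Lemma le_integral_ge0 (D : set R) (f g : R -> \bar R) :
  (forall t, D t -> 0 <= f t)%E -> (forall t, D t -> f t <= g t)%E ->
  (\int[mu]_(t in D) f t <= \int[mu]_(t in D) g t)%E.
Proof.
move=> f0 fg.
have g0 t : D t -> (0 <= g t)%E by move=> Dt; apply: le_trans (f0 _ Dt) (fg _ Dt).
rewrite !ge0_integralE//; apply: le_ereal_sup => _ [h hf <-]; exists h => // t.
apply: (le_trans (hf t)); rewrite /patch; case: ifP => // /set_mem; exact: fg.
Qed.

(** Only the dominating series of step functions is integrated term by term; overlaps of the
    intervals merely enlarge the bound. *)
Lemma integral_le_steps (D : set R) (f : R -> \bar R) (a b c : nat -> R) :
  measurable D ->
  (forall t, D t -> 0 <= f t)%E -> (forall k, a k <= b k) -> (forall k, 0 <= c k) ->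
  (forall t, D t -> exists2 k, a k <= t <= b k & (f t <= (c k)%:E)%E) ->
  (\int[mu]_(t in D) f t <= \sum_(0 <= k <oo) (c k * (b k - a k))%:E)%E.
Proof.
move=> mD f0 ab c0 H.
pose g k t := ((c k)%:E * (\1_`[a k, b k] t)%:E)%E.
have g0 k t : (0 <= g k t)%E by rewrite mule_ge0// lee_fin.
apply: (@le_trans _ _ (\int[mu]_(t in D) (\sum_(0 <= k <oo) g k t))%E).
  apply: le_integral_ge0 => // t Dt; have [k tk fk] := H t Dt.
  apply: (le_trans fk); apply: le_trans (nneseries_lim_ge k.+1 _) => //.
  rewrite big_nat_recr//= (_ : (c k)%:E = g k t); first by rewrite leeDr// sume_ge0.
  by rewrite /g indicE mem_set ?mule1//= in_itv.
have mg k : measurable_fun D (g k).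
  by apply: measurable_funeM; apply/measurable_EFinP; exact: measurable_indic.
rewrite integral_nneseries//; apply: lee_nneseries => [k _ _|k _]; first exact: integral_ge0.
rewrite ge0_integralZl ?lee_fin//; last first.
  by apply/measurable_EFinP; exact: measurable_indic.
rewrite integral_indic// EFinM lee_wpmul2l ?lee_fin//.
rewrite (le_trans (le_measure _ _ _ (@subIsetl _ _ _)))//= ?inE//.
- exact: measurableI.
by rewrite lebesgue_measure_itv/= lte_fin; case: ltP => //; rewrite lee_fin subr_ge0.
Qed.

Lemma geometric_eseries_lty (a z : R) : 0 <= a -> 0 < z < 1 ->
  (\sum_(0 <= k <oo) (a * z ^+ k)%:E < +oo)%E.
Proof.
move=> a0 /andP[z0 z1]; apply: (@le_lt_trans _ _ (a / (1 - z))%:E); last exact: ltry.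
apply: lime_le.
  by apply: is_cvg_nneseries => k _ _; rewrite lee_fin mulr_ge0// exprn_ge0// ltW.
near=> k; rewrite sumEFin lee_fin.
by have := @geometric_le_lim R k a z a0 z0; rewrite ger0_norm ?(ltW z0)// => /(_ z1).
Unshelve. all: by end_near. Qed.

Lemma dyadic_bracket (t : R) : 1 <= t -> exists k : nat, 2 ^+ k <= t <= 2 ^+ k.+1.
Proof.
move=> t1; have [N tN] : exists N : nat, t < 2 ^+ N.
  exists (Num.truncn t).+1; rewrite (lt_trans (truncnS_gt t))// -natrX ltr_nat.
  exact: ltn_expl.
elim: N tN => [|N IH]; first by rewrite expr0; lra.
by case: (ltP t (2 ^+ N)) => [/IH//|tN tN']; exists N; rewrite tN ltW.
Qed.

Lemma ltr_powR (a x y : R) : 1 < a -> x < y -> powR a x < powR a y.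
Proof.
move=> a1 xy; have a0 : 0 < a by lra.
rewrite -[y](subrK x) powRD ?(gt_eqF a0) ?implybT// ltr_pMl ?powR_gt0//.
have {1}<- : powR 1 (y - x) = 1 by rewrite powR1.
rewrite gt0_ltr_powR ?nnegrE ?subr_gt0//; exact: ltW.
Qed.

Lemma powR_exprn (x a : R) k : 0 <= x -> powR (x ^+ k) a = powR x a ^+ k.
Proof. by move=> x0; rewrite -!powR_mulrn ?powR_ge0// -!powRrM mulrC. Qed.

Lemma lty_integral_tail (f : R -> \bar R) (K b : R) : 0 <= K -> 1 < b ->
  (forall t, 1 <= t -> (0 <= f t)%E) ->
  (forall t, 1 <= t -> (f t <= (K * powR t (- b))%:E)%E) ->
  (\int[mu]_(t in [set t : R | (1 <= t)%R]) f t < +oo)%E.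
Proof.
move=> K0 b1 f0 fK.
have md := measurable_ge1.
(* The block from [2 ^+ k] to [2 ^+ k.+1] contributes at most [K * z ^+ k]. *)
pose z := 2 * powR 2 (- b) : R.
have z0 : 0 < z by rewrite mulr_gt0// powR_gt0.
have z1 : z < 1.
  rewrite /z -[X in X * _]powRr1// -powRD ?pnatr_eq0 ?implybT//.
  rewrite -[ltRHS](powRr0 2) ltr_powR//; lra.
apply: le_lt_trans (geometric_eseries_lty K0 (introT andP (conj z0 z1))).
apply: le_trans (@integral_le_steps _ f (fun k => 2 ^+ k) (fun k => 2 ^+ k.+1)
  (fun k => K * powR (2 ^+ k) (- b)) _ _ _ _ _) _ => //.
- by move=> k; rewrite exprS ler_peMl ?exprn_ge0// ler1n.
- by move=> k; rewrite mulr_ge0 ?powR_ge0.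
- move=> t /= t1; have [k /andP[k1 k2]] := dyadic_bracket t1; exists k; rewrite ?k1//.
  rewrite (le_trans (fK _ t1))// lee_fin ler_wpM2l// !powRN lef_pV2 ?posrE ?powR_gt0 ?exprn_gt0//.
    by rewrite ge0_ler_powR// ?nnegrE ?exprn_ge0//; lra.
  by lra.
- apply: lee_nneseries => k _; rewrite lee_fin.
    by rewrite !mulr_ge0 ?powR_ge0// exprS subr_ge0 ler_peMl ?exprn_ge0// ler1n.
  by rewrite powR_exprn// /z exprMn exprS le_eqVlt; apply/orP; left; apply/eqP; ring.
Qed.

Lemma lty_integral_head (f : R -> \bar R) (K a : R) : 0 <= K -> 0 <= a < 1 ->
  (forall t, 0 < t <= 1 -> (0 <= f t)%E) ->
  (forall t, 0 < t <= 1 -> (f t <= (K * powR t (- a))%:E)%E) ->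
  (\int[mu]_(t in [set t : R | (0 < t <= 1)%R]) f t < +oo)%E.
Proof.
move=> K0 /andP[a0 a1] f0 fK.
have md := measurable_gt0_le1.
(* The block from [(2 ^+ k.+1)^-1] to [(2 ^+ k)^-1] contributes at most [K * z ^+ k.+1], hence the
   extra factor in [K2]. *)
pose z := powR 2 a / 2 : R.
have z0 : 0 < z by rewrite divr_gt0// powR_gt0.
have z1 : z < 1.
  by rewrite /z ltr_pdivrMr// mul1r -[ltRHS]powRr1// ltr_powR//; lra.
have K2 : 0 <= K * (powR 2 a / 2) by rewrite mulr_ge0// ltW.
apply: le_lt_trans (geometric_eseries_lty K2 (introT andP (conj z0 z1))).
apply: le_trans (@integral_le_steps _ f (fun k => (2 ^+ k.+1)^-1) (fun k => (2 ^+ k)^-1)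
  (fun k => K * powR (2 ^+ k.+1) a) _ _ _ _ _) _ => //.
- by move=> k; rewrite lef_pV2 ?posrE ?exprn_gt0// exprS ler_peMl ?exprn_ge0// ler1n.
- by move=> k; rewrite mulr_ge0 ?powR_ge0.
- move=> t /= t01; have /andP[t0 t1] := t01; have t1' : 1 <= t^-1 by rewrite invf_ge1.
  have [k /andP[k1 k2]] := dyadic_bracket t1'; exists k.
    by rewrite -[X in _ <= X <= _]invrK !lef_pV2 ?posrE ?exprn_gt0 ?invr_gt0// k1 k2.
  rewrite (le_trans (fK _ t01))// lee_fin ler_wpM2l//.
  have {1}-> : t = powR t^-1 (-1) by rewrite powR_inv1 ?invr_ge0 ?(ltW t0)// invrK.
  rewrite -powRrM mulN1r opprK ge0_ler_powR// ?nnegrE ?exprn_ge0 ?invr_ge0 ?(ltW t0)//.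
- apply: lee_nneseries => k _; rewrite lee_fin.
    by rewrite !mulr_ge0 ?powR_ge0// subr_ge0 lef_pV2 ?posrE ?exprn_gt0// exprS ler_peMl ?exprn_ge0// ler1n.
  rewrite powR_exprn// /z expr_div_n !exprS le_eqVlt; apply/orP; left; apply/eqP.
  by field; rewrite expf_neq0.
Qed.
(** Additivity of the integral is applied to the measurable majorant [g1 + g2] and not to [f]. The
    two domains share [t = 1], which is harmless for an upper bound. *)
Lemma lty_integral_powR (f : R -> \bar R) (K a b : R) :
  0 <= K -> 0 <= a < 1 -> 1 < b ->
  (forall t, 0 < t -> (0 <= f t)%E) ->
  (forall t, 0 < t <= 1 -> (f t <= (K * powR t (- a))%:E)%E) ->
  (forall t, 1 <= t -> (f t <= (K * powR t (- b))%:E)%E) ->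
  (\int[mu]_(t in [set t : R | (0 < t)%R]) f t < +oo)%E.
Proof.
move=> K0 a01 b1 f0 fa fb.
pose D := [set t : R | (0 < t)%R].
pose A := [set t : R | (0 < t <= 1)%R].
pose B := [set t : R | (1 <= t)%R].
have mD : measurable D := measurable_gt0.
have mA : measurable A := measurable_gt0_le1.
have mB : measurable B := measurable_ge1.
have mg (e : R) : measurable_fun setT (fun t => (K * powR t e)%:E).
  by apply/measurable_EFinP; apply: measurable_funM => //; exact: measurable_powR.
have g0 (e : R) t : (0 <= (K * powR t e)%:E)%E by rewrite lee_fin mulr_ge0 ?powR_ge0.
pose g1 := (fun t => (K * powR t (- a))%:E) \_ A.
pose g2 := (fun t => (K * powR t (- b))%:E) \_ B.
have p0 (e : R) (Z : set R) t : (0 <= ((fun t => (K * powR t e)%:E) \_ Z) t)%E.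
  by rewrite /patch; case: ifP.
have mp (e : R) (Z : set R) : measurable Z -> measurable_fun D ((fun t => (K * powR t e)%:E) \_ Z).
  move=> mZ; apply: (@measurable_funS _ _ _ _ setT) => //.
  by apply/(measurable_restrictT _ mZ); exact: measurable_funS (mg e).
apply: (@le_lt_trans _ _ (\int[mu]_(t in D) (g1 t + g2 t))%E).
  apply: le_integral_ge0 => // t; rewrite /D/= => t0; have [t1|t1] := leP t 1.
    have At : A t by rewrite /A/= t0.
    by rewrite (le_trans (fa _ At))// /g1 patchT ?inE// leeDl// p0.
  have Bt : B t by exact: ltW.
  by rewrite (le_trans (fb _ Bt))// /g2 [X in (_ + X)%E]patchT ?inE// leeDr// p0.
rewrite ge0_integralD//; [|by move=> *; exact: p0|exact: mp|by move=> *; exact: p0|exact: mp].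
have DA : D `&` A = A by apply/seteqP; split=> [t []|t]//; rewrite /D /A /= => /andP[-> ->].
have DB : D `&` B = B by apply/seteqP; split=> [t []|t]//; rewrite /D /B /= => t1; split=> //; exact: lt_le_trans t1.
rewrite -!integral_mkcondr DA DB lte_add_pinfty//.
  by apply: (@lty_integral_head _ K a).
by apply: (@lty_integral_tail _ K b).
Qed.

(** On disjoint half-open intervals at most one term of the series is nonzero at each point, so the
    series lies below [f]. *)
Lemma integral_ge_steps (D : set R) (f : R -> \bar R) (a b c : nat -> R) :
  measurable D ->
  (forall t, D t -> (0 <= f t)%E) -> (forall k, a k <= b k) -> (forall k, 0 <= c k) ->
  (forall j k t, a j < t <= b j -> a k < t <= b k -> j = k) ->
  (forall k t, a k < t <= b k -> D t /\ ((c k)%:E <= f t)%E) ->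
  (\sum_(0 <= k <oo) (c k * (b k - a k))%:E <= \int[mu]_(t in D) f t)%E.
Proof.
move=> mD f0 ab c0 inj H.
pose g k t := ((c k)%:E * (\1_`]a k, b k] t)%:E)%E.
have g0 k t : (0 <= g k t)%E by rewrite mule_ge0// lee_fin.
have gE k t : a k < t <= b k -> g k t = (c k)%:E.
  by move=> tk; rewrite /g indicE mem_set ?mule1//= in_itv.
have gN k t : ~ (a k < t <= b k) -> g k t = 0%E.
  by move=> tk; rewrite /g indicE memNset ?mule0//= in_itv.
have mg k : measurable_fun D (g k).
  by apply: measurable_funeM; apply/measurable_EFinP; exact: measurable_indic.
apply: (@le_trans _ _ (\int[mu]_(t in D) (\sum_(0 <= k <oo) g k t))%E); last first.
  apply: le_integral_ge0 => t Dt; first by apply: nneseries_ge0 => *.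
  have [[k tk]|/forallNP Nt] := pselect (exists k, a k < t <= b k); last first.
    by rewrite eseries0 ?f0// => k _ _; exact/gN/Nt.
  rewrite (@nneseriesD1 _ _ k)// eseries0 ?adde0 => [|j _ /eqP jk]; last first.
    by apply: gN => /inj /(_ tk).
  by rewrite gE//; have [] := H _ _ tk.
rewrite integral_nneseries//; apply: lee_nneseries => [k _ _|k _].
  by rewrite lee_fin mulr_ge0// subr_ge0.
rewrite ge0_integralZl ?lee_fin//; last first.
  by apply/measurable_EFinP; exact: measurable_indic.
rewrite integral_indic// EFinM lee_wpmul2l ?lee_fin//.
rewrite setIidl => [|t /=]; last by rewrite in_itv/= => /H[].
rewrite /= lebesgue_measure_itv/= lte_fin; case: ltP => // ba.
by rewrite lee_fin subr_le0.
Qed.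

Lemma nneseries_cst_pinfty (c : R) : 0 < c -> (\sum_(0 <= k <oo) c%:E = +oo :> \bar R)%E.
Proof.
move=> c0; apply/eqyP => A A0.
apply: le_trans (nneseries_lim_ge (Num.truncn (A / c)).+1 _); last by move=> *; rewrite lee_fin ltW.
rewrite big_mkord sumEFin lee_fin sumr_const card_ord -[leRHS]mulr_natl.
by rewrite -ler_pdivrMr// ltW// truncnS_gt.
Qed.

Lemma dyadic_inj (j k : nat) (t : R) :
  2 ^+ j < t <= 2 ^+ j.+1 -> 2 ^+ k < t <= 2 ^+ k.+1 -> j = k.
Proof.
move=> /andP[j1 j2] /andP[k1 k2].
have := lt_le_trans j1 k2; have := lt_le_trans k1 j2.
by rewrite !ltr_eXn2l ?ltr1n//; lia.
Qed.

(** Logarithmic divergence: each dyadic block beyond [T] contributes at least [c / 2]. *)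
Lemma integral_pinfty_tail (f : R -> \bar R) (c T : R) : 0 < c -> 0 < T ->
  (forall t, 0 < t -> (0 <= f t)%E) ->
  (forall t, T <= t -> ((c / t)%:E <= f t)%E) ->
  (\int[mu]_(t in [set t : R | (0 < t)%R]) f t = +oo)%E.
Proof.
move=> c0 T0 f0 fc; apply/eqP; rewrite -leye_eq.
rewrite -(@nneseries_cst_pinfty (c / 2)) ?divr_gt0//.
have md := measurable_gt0.
have e0 (k : nat) : 0 < 2 ^+ k :> R by rewrite exprn_gt0.
have e1 (k : nat) : 1 <= 2 ^+ k :> R by rewrite exprn_ege1// ler1n.
apply: le_trans (@integral_ge_steps _ f (fun k => T * 2 ^+ k) (fun k => T * 2 ^+ k.+1)
  (fun k => c / (T * 2 ^+ k.+1)) md f0 _ _ _ _).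
- apply: lee_nneseries => k _; rewrite lee_fin ?divr_ge0 ?(ltW c0)//.
  rewrite exprS le_eqVlt; apply/orP; left; apply/eqP; field.
  by rewrite !gt_eqF.
- by move=> k; rewrite ler_pM2l// exprS ler_peMl ?ler1n ?(ltW (e0 _)).
- by move=> k; rewrite divr_ge0 ?mulr_ge0 ?(ltW c0) ?(ltW T0) ?(ltW (e0 _)).
- move=> j k t; rewrite ![T * _]mulrC -!ltr_pdivlMr// -!ler_pdivrMr//; exact: dyadic_inj.
- move=> k t /andP[t1 t2]; have t0 : 0 < t by apply: lt_trans t1; rewrite mulr_gt0.
  split=> //; apply: le_trans (fc t _); last by rewrite (le_trans _ (ltW t1))// ler_peMr// ltW.
  by rewrite lee_fin ler_pM2l// lef_pV2 ?posrE// mulr_gt0.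
Qed.

(** The same divergence at 0, with blocks halving downward from [T]. *)
Lemma integral_pinfty_head (f : R -> \bar R) (c T : R) : 0 < c -> 0 < T ->
  (forall t, 0 < t -> (0 <= f t)%E) ->
  (forall t, 0 < t <= T -> ((c / t)%:E <= f t)%E) ->
  (\int[mu]_(t in [set t : R | (0 < t)%R]) f t = +oo)%E.
Proof.
move=> c0 T0 f0 fc; apply/eqP; rewrite -leye_eq.
rewrite -(@nneseries_cst_pinfty (c / 2)) ?divr_gt0//.
have md := measurable_gt0.
have e0 (k : nat) : 0 < 2 ^+ k :> R by rewrite exprn_gt0.
have e1 (k : nat) : 1 <= 2 ^+ k :> R by rewrite exprn_ege1// ler1n.
apply: le_trans (@integral_ge_steps _ f (fun k => T / 2 ^+ k.+1) (fun k => T / 2 ^+ k)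
  (fun k => c / (T / 2 ^+ k)) md f0 _ _ _ _).
- apply: lee_nneseries => k _; rewrite lee_fin ?divr_ge0 ?(ltW c0)//.
  rewrite exprS le_eqVlt; apply/orP; left; apply/eqP; field.
  by rewrite !gt_eqF.
- by move=> k; rewrite ler_pM2l// lef_pV2 ?posrE// exprS ler_peMl ?ler1n ?(ltW (e0 _)).
- by move=> k; rewrite !divr_ge0 ?(ltW c0) ?(ltW T0) ?(ltW (e0 _)).
- move=> j k t; rewrite !ltr_pdivrMr// !ler_pdivlMr// => /andP[j1 j2] /andP[k1 k2].
  have t0 : 0 < t by rewrite -(pmulr_lgt0 _ (e0 j.+1)) (lt_trans T0).
  have := le_lt_trans k2 j1; have := le_lt_trans j2 k1.
  by rewrite !ltr_pM2l// !ltr_eXn2l ?ltr1n//; lia.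
- move=> k t /andP[t1 t2]; have t0 : 0 < t by apply: lt_trans t1; rewrite divr_gt0.
  split=> //; apply: le_trans (fc t _); last by rewrite t0 (le_trans t2)// ler_pdivrMr// ler_peMr// ltW.
  by rewrite lee_fin ler_pM2l// lef_pV2 ?posrE// divr_gt0.
Qed.
End Integrals.

(** * Cones, pseudo-cones and asymptotic sets *)

Section Cones.
Context {R : realType} {n : nat}.
Implicit Types (C E A S : set 'rV[R]_n) (x y v : 'rV[R]_n).

Lemma interior_normP S x :
  interior S x <-> exists2 e : R, 0 < e & forall y, `|y - x| < e -> S y.
Proof.
split=> [/nbhs_ballP[e /= e0 eS]|[e e0 eS]].
  by exists e => // y yx; apply: eS; rewrite -ball_normE /= distrC.
apply/nbhs_ballP; exists e => //= y; rewrite -ball_normE /= distrC; exact: eS.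
Qed.

Lemma closed_normP S x : closed S ->
  (forall e : R, 0 < e -> exists2 y, S y & `|y - x| < e) -> S x.
Proof.
move=> cS H; apply: cS => U /nbhs_ballP[e /= e0 eU].
have [y Sy yx] := H _ e0; exists y; split=> //; apply: eU.
by rewrite -ball_normE /= distrC.
Qed.

Lemma closure_normP S x (e : R) : closure S x -> 0 < e -> exists2 y, S y & `|y - x| < e.
Proof.
move=> cS e0; have [y [Sy]] := cS _ (nbhsx_ballx x e e0).
by rewrite -ball_normE /= distrC; exists y.
Qed.

Lemma interior_convex_cone C y s : pointed_cone C -> interior C y -> 0 < s ->
  interior C (s *: y).
Proof.
move=> [_ Cs _ _ _] /interior_normP[e e0 eC] s0.
apply/interior_normP; exists (s * e); first exact: mulr_gt0.
move=> v vy; have -> : v = s *: (s^-1 *: v) by rewrite scalerA divff ?gt_eqF// scale1r.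
apply: Cs; last exact: ltW.
apply: eC; have -> : s^-1 *: v - y = s^-1 *: (v - s *: y).
  by rewrite scalerBr scalerA mulVf ?gt_eqF// scale1r.
by rewrite normrZ normfV (gtr0_norm s0) ltr_pdivrMl.
Qed.

(** For [x] and [y] in [E] the points [(1 - 1 / k) y + (1 / k) (k x)] of [E] tend to [y + x], so [x]
    is a recession direction. *)
Lemma pseudo_cone_sub C E : pseudo_cone C E -> E `<=` C.
Proof.
move=> [_ cE vE _ [lE rE]] x Ex; rewrite -rE => y Ey; apply: closed_normP => // e e0.
pose k := (Num.truncn (`|y| / e)).+1%:R : R.
have k1 : 1 <= k by rewrite ler1n.
have k0 : 0 < k by exact: lt_le_trans k1.
exists ((1 - k^-1) *: y + k^-1 *: (k *: x)).
  by apply: vE => //; [exact: lE|rewrite invr_ge0 ltW//= invf_le1].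
rewrite scalerA mulVf ?gt_eqF// scale1r scalerBl scale1r.
rewrite (_ : _ - _ = - (k^-1 *: y)); last by rewrite opprD addrACA subrr addr0 addrAC subrr add0r.
rewrite normrN normrZ normfV (gtr0_norm k0) ltr_pdivrMl// mulrC -ltr_pdivrMl// mulrC.
exact: truncnS_gt.
Qed.

Lemma pseudo_cone_add C E x c : pseudo_cone C E -> E x -> C c -> E (x + c).
Proof. by move=> [_ _ _ _ [_ <-]] Ex; apply. Qed.

Lemma closed_avoid0 S : closed S -> ~ S 0 -> exists2 r : R, 0 < r & forall x, S x -> r <= `|x|.
Proof.
move=> cS S0; have : interior (~` S) 0 by move: cS; rewrite -openC => /interior_id ->.
move=> /interior_normP[r r0 rS]; exists r => // x Sx; rewrite leNgt; apply/negP => xr.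
by apply: (rS x) => //; rewrite subr0.
Qed.

Lemma compact_unit_sphere C : closed C -> compact (C `&` [set x | `|x| = 1]).
Proof.
move=> clC; apply: bounded_closed_compact.
  by exists 1; split=> // M M1 x [_ /= ->]; exact: ltW.
apply: closedI => //.
apply: (@closed_comp _ _ (fun x : 'rV[R]_n => `|x|) [set 1 : R]) => [x _|].
  exact: norm_continuous.
exact: closed_eq.
Qed.

(* By compactness of the unit sphere of C: pointedness keeps -C away from it. *)
Lemma cone_norm_add C : pointed_cone C ->
  exists2 k : R, 0 < k & forall x c, C x -> C c -> k * `|x| <= `|x + c|.
Proof.
move=> [C0 Cs CD _ [clC pC _]].
pose K := C `&` [set x | `|x| = 1].
have cK : compact K := compact_unit_sphere clC.
have /compact_near_coveringP cov := cK.
(* A bound valid near each unit vector is made uniform by compactness in its near-covering form. *)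
have : \forall e \near (0 : R)^'+, K `<=` (fun u => forall c, C c -> e <= `|u + c|).
  apply: (cov R 0^'+ (fun e u => forall c, C c -> e <= `|u + c|)) => u [Cu /= u1].
  have Nu : ~ C (- u) by move=> /(pC _ Cu) u0; move: u1; rewrite u0 normr0 => /eqP; rewrite eq_sym oner_eq0.
  (* A small [u + c] would put [c] near [- u], which lies outside the closed set [C]. *)
  have [e e0 eC] : exists2 e : R, 0 < e & forall c, C c -> e <= `|u + c|.
    have : interior (~` C) (- u) by move: clC; rewrite -openC => /interior_id ->.
    move=> /interior_normP[e e0 eC]; exists e => // c Cc; rewrite leNgt; apply/negP => uc.
    by apply: (eC c) => //; rewrite opprK addrC.
  exists (ball u (e / 2), [set t | t < e / 2]); first split=> /=.
  - by apply: nbhsx_ballx; rewrite divr_gt0.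
  - by apply: nbhs_right_lt; rewrite divr_gt0.
  - move=> [v t] /= [uv te] c Cc; have := eC _ Cc.
    have -> : u + c = (u - v) + (v + c) by rewrite addrA subrK.
    move=> /le_trans /(_ (ler_normD _ _)); move: uv; rewrite -ball_normE /=; move: te.
    lra.
move=> /(filterI (nbhs_right_gt 0)) /filter_ex [k [k0 kK]].
exists k => // x c Cx Cc; have [->|x0] := eqVneq x 0; first by rewrite normr0 mulr0.
have nx : 0 < `|x| by rewrite normr_gt0.
have H : K (`|x|^-1 *: x).
  split; first by apply: Cs => //; rewrite invr_ge0.
  by rewrite /= normrZ normfV normr_id mulVf// gt_eqF.
have := kK _ H (`|x|^-1 *: c).
rewrite -scalerDr normrZ normfV normr_id ler_pdivlMl// mulrC; apply.
by apply: Cs => //; rewrite invr_ge0.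
Qed.

(** The apex [e] is the midpoint of the interior point [a] and a very distant [x] of [A]. Then
    [e + C] is contained in [a / 2 + C] and far enough from 0 to avoid [bd A], so no segment from
    [e] in a direction of [C] can leave [A]. *)
Lemma asymptotic_translate C A : pointed_cone C -> asymptotic_set C A ->
  exists2 e, C e & forall c, C c -> A (e + c).
Proof.
move=> hC [ubA clA cvA AC [[a /[dup] Aa0 /interior_normP[r r0 rA]] _ asym]].
have [k k0 kC] := cone_norm_add hC.
have [C0 Cs CD _ [clC pC _]] := hC.
have Aa : A a by apply: rA; rewrite subrr normr0.
have [M HM] := asym (r / 2) (divr_gt0 r0 (ltr0n _ 2)).
(* As [2 |e| >= |x| - |a|] and [|e + c| >= k |e|], this threshold forces [|e + c| > M]. *)
have [x Ax xM] : exists2 x, A x & (2 * Num.max M 0 + 1) / k + `|a| < `|x|.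
  apply: contrapT => H; apply: ubA; exists (n%:R * ((2 * Num.max M 0 + 1) / k + `|a|)) => x Ax.
  rewrite (le_trans (enorm_le _))// ler_wpM2l// leNgt; apply/negP => ?; apply: H; by exists x.
pose e := 2^-1 *: a + 2^-1 *: x.
have Ae : A e.
  have -> : e = (1 - 2^-1) *: a + 2^-1 *: x by congr (_ *: _ + _); field.
  by apply: cvA => //; lra.
(* Points of a/2 + C stay at distance r/2 from the boundary of C. *)
have far c y : C c -> `|y - (e + c)| < r / 2 -> interior C y.
  move=> Cc yc; apply/interior_normP; exists (r / 2 - `|y - (e + c)|); first by rewrite subr_gt0.
  move=> v vy.
  (* The deviation of [v] from [e + c], of norm below [r / 2], is doubled and absorbed at [a]. *)
  have -> : v = 2^-1 *: (a + 2 *: (v - (e + c))) + (2^-1 *: x + c).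
    by apply/matrixP => i j; rewrite /e !mxE; field.
  apply: (CD); last by apply: (CD) => //; apply: Cs => //; exact: AC.
  apply: Cs => //; apply: AC; apply: rA.
  rewrite addrAC subrr add0r normrZ ger0_norm//.
  have -> : v - (e + c) = (v - y) + (y - (e + c)) by rewrite addrA subrK.
  have := ler_normD (v - y) (y - (e + c)); lra.
have bdfar c : C c -> ~ bd A (e + c).
  move=> Cc bdA; have Me : M < enorm (e + c).
    rewrite (lt_le_trans _ (norm_le_enorm _))//.
    have Ce : C e by exact: AC.
    apply: lt_le_trans (kC _ _ Ce Cc).
    have ne : `|x| - `|a| <= 2 * `|e|.
      have -> : 2 * `|e| = `|a + x|.
        by rewrite /e -scalerDr normrZ ger0_norm ?invr_ge0// mulrA divff ?mul1r.
      have := ler_normB (a + x) a; rewrite [a + x]addrC addrK; lra.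
    have : (2 * Num.max M 0 + 1) / k < 2 * `|e| by lra.
    rewrite ltr_pdivrMr// => He; have : M <= Num.max M 0 by rewrite le_max lexx.
    lra.
  have := HM _ bdA Me; rewrite ltNge => /negP; apply.
  apply: le_ereal_inf_tmp => _ [y bdy <-]; rewrite lee_fin leNgt; apply/negP => ye.
  case: bdy => _; apply; apply: (far _ _ Cc).
  by rewrite distrC (le_lt_trans (norm_le_enorm _)).
exists e => [|c Cc]; first exact: AC.
pose f (t : R) := e + t *: c.
have cf : continuous f by move=> t; apply: cvgD; [exact: cvg_cst|apply: cvgZr_tmp; exact: cvg_id].
have Cf t : 0 <= t -> C (t *: c) by move=> t0; exact: Cs.
(* With no boundary point on the segment, the preimage of [A] is both open and closed in [[0, 1]],
   and it contains 0. *)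
have e1 : `[0, 1]%classic `&` f @^-1` A = `[0, 1]%classic `&` f @^-1` (interior A).
  apply/seteqP; split=> t [t01 /= At]; split=> //; last exact: interior_subset.
  move: t01; rewrite /= in_itv/= => /andP[t0 _].
  apply: contrapT => Nt; apply: (bdfar _ (Cf _ t0)); split=> //; exact: subset_closure.
have /seteqP[_ /(_ 1)] : `[0, 1]%classic `&` f @^-1` A = `[0, 1]%classic.
apply: (@segment_connected R 0 1).
- by exists 0; split; rewrite /= ?in_itv/= ?lexx ?ler01// /f scale0r addr0.
- exists (f @^-1` (interior A)) => //; apply: open_comp => //; exact: open_interior.
- exists (f @^-1` A) => //; apply: closed_comp => //.
rewrite /= in_itv/= ler01 lexx => /(_ isT)[_].
by rewrite /f scale1r.
Qed.

End Cones.

(** * Growth of Hausdorff measures of sets constrained by a cone *)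

Section ConeEstimates.
Context {R : realType} {n : nat}.
Implicit Types (C E A S : set 'rV[R]_n) (x y v w : 'rV[R]_n).

Lemma hausdorff_mono k S T : S `<=` T -> (hausdorff k S <= hausdorff k T)%E.
Proof.
move=> ST; apply: ge_ereal_sup => _ [d /= d0 <-].
apply: (@le_trans _ _ (haus_delta k d T)); last by apply: ereal_sup_ubound; exists d.
apply: le_ereal_inf => _ [U [TU [Ud ->]]]; exists U; split=> //.
exact: subset_trans TU.
Qed.

Lemma hausdorff_ge0 k S : (0 <= hausdorff k S)%E.
Proof.
apply: (@le_trans _ _ (haus_delta k 1 S)); last by apply: ereal_sup_ubound; exists 1 => //=.
apply: le_ereal_inf_tmp => _ [U [_ [_ ->]]].
by apply: nneseries_ge0 => *; exact: haus_piece_ge0.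
Qed.

Lemma hausdorff_set0 k : (0 < k)%N -> hausdorff k (@set0 'rV[R]_n) = 0%E.
Proof.
move=> k0; apply/eqP; rewrite eq_le hausdorff_ge0 andbT.
have := @hausdorff_finite_cover R n k set0 0; rewrite mulr0; apply => d d0.
by exists void, (fun=> set0), 0; split; rewrite ?expr0n ?gtn_eqF ?mulr0 ?(ltW d0)// => -[].
Qed.

Lemma interior_cone_neq0 C e : (0 < n)%N -> pointed_cone C -> interior C e -> e != 0.
Proof.
move=> n0 [_ _ _ _ [_ pC _]] /interior_normP[d d0 dC]; apply/eqP => e0.
pose v : 'rV[R]_n := const_mx (d / 2).
have vd : `|v| < d.
  rewrite (@le_lt_trans _ _ (d / 2))//; last lra.
  by apply: norm_le_coord => [|i]; rewrite ?mxE ?ger0_norm// ltW// divr_gt0.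
have v0 : v = 0 by apply: pC; apply: dC; rewrite e0 subr0 ?normrN.
have := congr1 (fun u : 'rV[R]_n => u ord0 (Ordinal n0)) v0; rewrite !mxE; lra.
Qed.

(** [p] projects along an interior direction [e] and drops a coordinate where [e] does not vanish.
    The two non-membership conditions bound the [e]-coordinate of [v] from above and from below. The
    case [w = 0] serves Lipschitz graphs, general [w] serves slabs. *)
Lemma cone_projection C : (0 < n)%N -> pointed_cone C ->
  exists (p : 'rV[R]_n -> 'rV[R]_n.-1) (c L : R),
  [/\ 0 < c, 0 < L, forall x y, p x - p y = p (x - y), forall v, `|p v| <= c * `|v| &
      forall v w, ~ interior C (v - w) -> ~ interior C (- v - w) ->
        `|v| <= L * (`|p v| + `|w|)].
Proof.
move=> n0 hC; have [C0 Cs CD cvC [clC pC [e /[dup] Ce0 /interior_normP[d d0 dC]]]] := hC.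
have Ce : C e by apply: dC; rewrite subrr normr0.
have /rV0Pn[i0 ei0] := interior_cone_neq0 n0 hC Ce0.
pose s v := v ord0 i0 / e ord0 i0.
pose u v := v - s v *: e.
pose p v := col' i0 (u v).
have uv v : `|u v| = `|p v|.
  apply/eqP; rewrite eq_le; apply/andP; split; apply: norm_le_coord => // i.
    case: (unliftP i0 i) => [j ->|->].
      by have := coord_le_norm (p v) j; rewrite [in X in X -> _]mxE.
    by rewrite !mxE /s divfK// subrr normr0.
  by rewrite mxE coord_le_norm.
have sN v : s (- v) = - s v by rewrite /s mxE mulNr.
have uN v : u (- v) = - u v by rewrite /u sN scaleNr opprD.
(* If the e-coordinate of v dominates its transverse part then v - w is in int C. *)
have half v w : ~ interior C (v - w) -> s v <= 2 / d * (`|u v| + `|w|).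
  move=> Nvw; rewrite leNgt; apply/negP => sv; apply: Nvw.
  have s0 : 0 < s v by rewrite (le_lt_trans _ sv)// mulr_ge0 ?divr_ge0 ?addr_ge0 ?(ltW d0).
  have -> : v - w = s v *: (e + (s v)^-1 *: (u v - w)).
    rewrite scalerDr scalerA divff ?gt_eqF// scale1r /u.
    by rewrite addrA [_ *: e + _]addrC subrK.
  apply: interior_convex_cone => //; apply/interior_normP; exists (d / 2); first by rewrite divr_gt0.
  move=> y ye; apply: dC; pose z := (s v)^-1 *: (u v - w).
  have -> : y - e = (y - (e + z)) + z by rewrite opprD addrA subrK.
  rewrite (le_lt_trans (ler_normD _ _))//.
  suff : `|z| < d / 2 by move: ye; rewrite -/z; lra.
  rewrite normrZ normfV (gtr0_norm s0) ltr_pdivrMl//.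
  rewrite (le_lt_trans (ler_normB _ _))//.
  by move: sv; rewrite mulrAC ltr_pdivrMr//; lra.
(* Both constants come from [v = u v + s v *: e]: the first bounds [u v] by [v], the second [v] by
   [u v] and [w]. *)
exists p, (1 + `|e| / `|e ord0 i0|), (1 + 2 / d * `|e|).
have en0 : 0 <= `|e| / `|e ord0 i0| by rewrite divr_ge0.
have de0 : 0 <= 2 / d * `|e| by rewrite mulr_ge0// divr_ge0// ltW.
split; [lra|lra|..].
- move=> x y; apply/rowP => j; rewrite !mxE /s !mxE; ring.
- move=> v; rewrite -uv (le_trans (ler_normB _ _))// mulrDl mul1r lerD2l normrZ.
  have -> : `|s v| * `|e| = `|e| / `|e ord0 i0| * `|v ord0 i0| by rewrite normrM normfV; ring.
  by rewrite ler_wpM2l// coord_le_norm.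
- move=> v w v1 v2; have s1 := half _ _ v1; have := half _ _ v2; rewrite sN uN normrN => s2.
  have sv : `|s v| <= 2 / d * (`|u v| + `|w|) by rewrite ler_norml; apply/andP; split; lra.
  have {1}-> : v = u v + s v *: e by rewrite subrK.
  rewrite (le_trans (ler_normD _ _))// normrZ -uv.
  have : `|s v| * `|e| <= 2 / d * (`|u v| + `|w|) * `|e| by rewrite ler_wpM2r.
  have := normr_ge0 w; rewrite mulrDl mul1r mulrAC; lra.
Qed.

(** With [w = 0] and both orders of [x] and [y], [p] is injective on [S] with Lipschitz inverse, so
    [S] grows like its projection. *)
Lemma hausdorff_cone_boundary C S : (0 < n)%N -> pointed_cone C ->
  (forall x y, S x -> S y -> ~ interior C (x - y)) ->
  exists2 K : R, 0 <= K & forall r, 0 < r ->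
    (hausdorff n.-1 (S `&` [set x | (`|x| <= r)%R]) <= (K * r ^+ n.-1)%:E)%E.
Proof.
move=> n0 hC SC; have [p [c [L [c0 L0 pB pc pL]]]] := cone_projection n0 hC.
exists (haus_const R n.-1 * (4 * n%:R * L * c) ^+ n.-1).
  by rewrite mulr_ge0 ?(ltW (haus_const_gt0 _))// exprn_ge0// !mulr_ge0 ?(ltW L0) ?(ltW c0).
move=> r r0; rewrite -mulrA -exprMn -[X in (X ^+ _)]mulrA.
apply: (@hausdorff_lipschitz _ _ _ _ p); rewrite ?(ltW L0) ?mulr_gt0//.
- by move=> x [_ /= xr]; rewrite (le_trans (pc _))// ler_pM2l.
- move=> x y [Sx _] [Sy _]; rewrite pB.
  have := pL (x - y) 0; rewrite normr0 addr0 !subr0 opprB.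
  by apply; exact: SC.
Qed.

(** Two points with equal projections are at distance at most [L * |w|], so [S] has bounded
    thickness over its projection. The summand 1 in [r + 1] accounts for small [r]. *)
Lemma hausdorff_cone_slab C S w : (0 < n)%N -> pointed_cone C ->
  (forall x y, S x -> S y -> ~ C (x - y - w)) ->
  exists2 K : R, 0 <= K & forall r, 0 < r ->
    (hausdorff n (S `&` [set x | (`|x| <= r)%R]) <= (K * (r + 1) ^+ n.-1)%:E)%E.
Proof.
move=> n0 hC SC; have [p [c [L [c0 L0 pB pc pL]]]] := cone_projection n0 hC.
pose L' := L * (1 + `|w|); have L'0 : 0 < L' by rewrite mulr_gt0// ltr_pwDl.
have hc := ltW (haus_const_gt0 n : 0 < haus_const R n).
exists (haus_const R n * ((8 * n%:R * L') ^+ n * (2 * (c + 1)) ^+ n.-1)).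
  apply: mulr_ge0 => //; apply: mulr_ge0; apply: exprn_ge0; last by lra.
  by apply: mulr_ge0; [rewrite mulr_ge0|exact: ltW].
move=> r r0; have r1 : 0 < r + 1 by lra.
apply: (le_trans (@hausdorff_slab _ _ _ _ p L' (c * r) L'0 _ _ _)).
- by rewrite mulr_gt0.
- by move=> x [_ /= xr]; rewrite (le_trans (pc _))// ler_pM2l.
- move=> x y [Sx _] [Sy _]; rewrite pB.
  have nI v : ~ C v -> ~ interior C v by move=> Nv /interior_subset.
  apply: (le_trans (pL (x - y) w _ _)); try (apply: nI; rewrite ?opprB; exact: SC).
  rewrite -mulrA ler_pM2l// mulrDl mul1r mulrDr mulr1.
  have := normr_ge0 (p (x - y)); have := normr_ge0 w.
  by have := mulr_ge0 (normr_ge0 w) (normr_ge0 (p (x - y))); lra.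
- rewrite lee_fin -[leRHS]mulrA; apply: ler_wpM2l => //; rewrite -[leRHS]mulrA.
  apply: ler_wpM2l; first by apply: exprn_ge0; apply: mulr_ge0; [rewrite mulr_ge0|exact: ltW].
  rewrite -exprMn lerXn2r ?nnegrE ?mulr_ge0 ?addr_ge0 ?mulr_ge0 ?(ltW c0) ?(ltW r0)//.
  by rewrite -mulrA ler_pM2l// mulrDl; have := mulr_ge0 (ltW c0) (ltW r0); nra.
Qed.

Lemma hausdorff_bounded S : exists2 K : R, 0 <= K & forall r, 0 < r ->
    (hausdorff n (S `&` [set x | (`|x| <= r)%R]) <= (K * r ^+ n)%:E)%E.
Proof.
have hc := ltW (haus_const_gt0 n : 0 < haus_const R n).
exists (haus_const R n * (4 * n%:R * 1) ^+ n).
  by rewrite mulr_ge0// exprn_ge0// !mulr_ge0.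
move=> r r0; rewrite -mulrA -exprMn.
apply: (@hausdorff_lipschitz _ _ _ _ id) => //; first by move=> x [].
by move=> x y _ _; rewrite mul1r.
Qed.

End ConeEstimates.

(** * Homogeneous weights *)

Section Weights.
Context {R : realType} {n : nat}.
Implicit Types (C E A S : set 'rV[R]_n) (x y v w : 'rV[R]_n).

Lemma powR_root (y : R) k : (0 < k)%N -> 0 <= y -> powR y k%:R^-1 ^+ k = y.
Proof.
move=> k0 y0; rewrite -powR_mulrn ?powR_ge0// -powRrM mulVf ?powRr1//.
by rewrite pnatr_eq0 -lt0n.
Qed.

Lemma powRVl (t a : R) : 0 < t -> powR t^-1 a = powR t (- a).
Proof. by move=> t0; rewrite -powR_inv1 ?(ltW t0)// -powRrM mulN1r. Qed.

(** By homogeneity only the unit sphere of [C] matters, where compactness bounds [Theta]. The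
    normalisation [1 <= M] later keeps the level radius at least 1 for [t <= 1]. *)
Lemma weight_upper C q (Theta : 'rV[R]_n -> R) : pointed_cone C ->
  admissible_weight C q Theta ->
  exists2 M : R, 1 <= M & forall x, C x -> x != 0 -> Theta x <= M * powR `|x| (- q).
Proof.
move=> [C0 Cs CD _ [clC pC _]] [cT T0 TZ].
pose K := C `&` [set x | `|x| = 1].
have cK : compact K := compact_unit_sphere clC.
have KC : K `<=` C `\ 0.
  by move=> x [Cx /= x1]; split=> // x0; move: x1; rewrite x0 normr0 => /eqP; rewrite eq_sym oner_eq0.
have cTK : {within K, continuous Theta} by exact: continuous_subspaceW cT.
have /compact_bounded [B [_ HB]] := continuous_compact cTK cK.
exists (Num.max 1 (B + 1)) => [|x Cx x0]; first by rewrite le_max lexx.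
have nx : 0 < `|x| by rewrite normr_gt0.
have Ku : K (`|x|^-1 *: x).
  split; first by apply: Cs => //; rewrite invr_ge0.
  by rewrite /= normrZ normfV normr_id mulVf// gt_eqF.
have {1}-> : x = `|x| *: (`|x|^-1 *: x) by rewrite scalerA divff ?gt_eqF// scale1r.
rewrite TZ//; last exact: KC.
rewrite mulrC ler_wpM2r ?powR_ge0//.
rewrite (le_trans (ler_norm _))//.
apply: (HB (Num.max 1 (B + 1))); first by rewrite lt_max ltrDl ltr01 orbT.
by exists (`|x|^-1 *: x).
Qed.

(** Near an interior point of [C], continuity keeps [Theta] above half its value there; homogeneity
    carries the bound to all dilates of the ball. *)
Lemma weight_lower C q (Theta : 'rV[R]_n -> R) : (0 < n)%N -> pointed_cone C ->
  admissible_weight C q Theta ->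
  exists (x0 : 'rV[R]_n) (d m : R), [/\ 0 < d, 0 < m &
    forall s v, 0 < s -> `|v - s *: x0| <= s * d ->
      C v /\ m * powR s (- q) <= Theta v].
Proof.
move=> n0 hC [cT T0 TZ].
have [C0 Cs CD _ [clC pC [e eC]]] := hC.
have e0 := interior_cone_neq0 n0 hC eC.
have [d d0 dC] := (interior_normP _ _).1 eC.
have CDe : (C `\ 0) e by split; [exact: interior_subset|exact/eqP].
have Te := T0 _ CDe.
have /interior_normP[r r0 rT] : interior [set y | (C `\ 0) y -> Theta e / 2 < Theta y] e.
  move/subspace_continuousP: cT => /(_ _ CDe).
  move=> /(_ [set u | Theta e / 2 < u]); apply.
  by apply: lt_nbhsr; rewrite ltr_pdivrMr// mulr_natr mulr2n ltrDl.
have ne : 0 < `|e| by rewrite normr_gt0.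
(* The ball must stay in [C], in the region of large [Theta] and away from 0; halving makes the
   inequalities strict. *)
pose d' := Num.min d (Num.min r `|e|) / 2.
have dmin : 0 < Num.min d (Num.min r `|e|) by rewrite !lt_min d0 r0.
have d'0 : 0 < d' by rewrite divr_gt0.
have : d' < Num.min d (Num.min r `|e|) by rewrite /d'; lra.
rewrite !lt_min => /and3P[d'd d'r d'e].
exists e, d', (Theta e / 2); split=> //; first by rewrite divr_gt0.
move=> s v s0 vs.
have vE : v = s *: (s^-1 *: v) by rewrite scalerA divff ?gt_eqF// scale1r.
have ve : `|s^-1 *: v - e| <= d'.
  have -> : s^-1 *: v - e = s^-1 *: (v - s *: e).
    by rewrite scalerBr scalerA mulVf ?gt_eqF// scale1r.
  by rewrite normrZ normfV (gtr0_norm s0) ler_pdivrMl.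
have uC : C (s^-1 *: v) by apply: dC; exact: le_lt_trans d'd.
have u0 : (C `\ 0) (s^-1 *: v).
  split=> //= u0; move: ve; rewrite u0 sub0r normrN => /le_lt_trans /(_ d'e).
  by rewrite ltxx.
rewrite vE; split; first by apply: Cs => //; exact: ltW.
rewrite TZ// mulrC ler_wpM2l ?powR_ge0// ltW// rT//.
exact: le_lt_trans d'r.
Qed.

(** * Finite integrals; [k] is the dimension of the measure, [d] the growth exponent of the set *)

Section Finite.
Variables (k d : nat) (S : set 'rV[R]_n) (Theta : 'rV[R]_n -> R) (q M : R).
Hypotheses (M1 : 1 <= M) (q0 : 0 < q) (dq : d%:R < q).
Hypothesis Theta_le : forall x, S x -> x != 0 -> Theta x <= M * powR `|x| (- q).

(** The radius [r] solving [M * r ^ (- q) = t], which bounds the level set of [Theta] above [t]. *)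
Let rho t := powR (M / t) q^-1.

Lemma level_radius t x : 0 < t -> S x -> t < Theta x -> `|x| <= rho t.
Proof.
move=> t0 Sx tx; have [->|x0] := eqVneq x 0; first by rewrite normr0 powR_ge0.
have nx : 0 < `|x| by rewrite normr_gt0.
have := lt_le_trans tx (Theta_le Sx x0).
rewrite powRN ltr_pdivlMr ?powR_gt0// mulrC -ltr_pdivlMr// => xq.
have -> : `|x| = powR (powR `|x| q) q^-1 by rewrite -powRrM divff ?gt_eqF// powRr1.
rewrite ge0_ler_powR ?nnegrE ?powR_ge0 ?invr_ge0 ?(ltW q0)// ?(ltW xq)//.
by rewrite divr_ge0 ?(ltW t0)// (le_trans _ M1).
Qed.

Lemma rho_exprn t j : 0 < t -> rho t ^+ j = powR M (j%:R / q) * powR t (- (j%:R / q)).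
Proof.
move=> t0; rewrite /rho -powR_mulrn ?powR_ge0// -powRrM [q^-1 * _]mulrC powRM ?powRVl//.
  exact: le_trans ler01 M1.
by rewrite invr_ge0 ltW.
Qed.

(** For [t <= 1], growth of order [d] bounds the integrand by a multiple of [t ^ (- d / q)],
    integrable at 0 since [d < q]. What remains is the decay for large [t], supplied below in two
    ways. *)
Lemma haus_wint_lty K K' b : 0 <= K -> 0 <= K' -> 1 < b ->
  (forall r, 0 < r ->
    (hausdorff k (S `&` [set x | (`|x| <= r)%R]) <= (K * (r + 1) ^+ d)%:E)%E) ->
  (forall t, 1 <= t ->
    (hausdorff k [set x | S x /\ (t < Theta x)%R] <= (K' * powR t (- b))%:E)%E) ->
  (haus_wint k Theta S < +oo)%E.
Proof.
move=> K0 K'0 b1 HK HK'.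
pose c := K * (2 ^+ d * powR M (d%:R / q)).
have c0 : 0 <= c by rewrite /c !mulr_ge0 ?powR_ge0// exprn_ge0.
apply: (@lty_integral_powR _ _ (c + K') (d%:R / q) b) => //.
- exact: addr_ge0.
- by rewrite divr_ge0 ?(ltW q0)//= ltr_pdivrMr// mul1r.
- by move=> t _; exact: hausdorff_ge0.
- move=> t /andP[t0 t1]; have Mt : 1 <= M / t by rewrite ler_pdivlMr// mul1r (le_trans t1).
  (* This allows [rho t + 1 <= 2 * rho t]. *)
  have r1 : 1 <= rho t.
    have {1}<- : powR 1 q^-1 = 1 by rewrite powR1.
    by rewrite ge0_ler_powR ?nnegrE ?invr_ge0 ?(ltW q0)// (le_trans _ Mt).
  have r0 : 0 < rho t by lra.
  apply: le_trans (hausdorff_mono _ _) (le_trans (HK _ r0) _).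
    by move=> x [Sx tx]; split=> //=; exact: level_radius.
  rewrite lee_fin; apply: (@le_trans _ _ (K * (2 * rho t) ^+ d)).
    by rewrite ler_wpM2l// lerXn2r ?nnegrE; lra.
  rewrite exprMn rho_exprn// !mulrA -[K * _ * _]mulrA -/c ler_wpM2r ?powR_ge0//.
  by rewrite lerDl.
- move=> t t1; rewrite (le_trans (HK' _ t1))// lee_fin ler_wpM2r ?powR_ge0//.
  by rewrite lerDr.
Qed.

(** Away from 0 the weight is bounded on [S], so high level sets are empty. *)
Lemma haus_wint_lty_far K r0 : (0 < k)%N -> 0 <= K -> 0 < r0 -> (forall x, S x -> r0 <= `|x|) ->
  (forall r, 0 < r ->
    (hausdorff k (S `&` [set x | (`|x| <= r)%R]) <= (K * (r + 1) ^+ d)%:E)%E) ->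
  (haus_wint k Theta S < +oo)%E.
Proof.
move=> k0 K0 r00 Sr HK.
have M0 : 0 < M by exact: lt_le_trans ltr01 M1.
pose T := M * powR r0 (- q); pose r1 := powR M q^-1.
have r10 : 0 < r1 by exact: powR_gt0.
(* For levels between 1 and [T] the measure is bounded by a constant, and the factor [T ^+ 2] turns
   it into a multiple of [t ^ (- 2)]; any exponent above 1 would do. *)
apply: (@haus_wint_lty K (K * (r1 + 1) ^+ d * T ^+ 2) 2) => //.
- by rewrite !mulr_ge0 ?exprn_ge0 ?mulr_ge0 ?powR_ge0 ?(ltW M0)// addr_ge0// ltW.
- by lra.
move=> t t1; have t0 : 0 < t by exact: lt_le_trans t1.
have [tT|Tt] := leP t T.
  apply: (@le_trans _ _ (hausdorff k (S `&` [set x | (`|x| <= r1)%R]))).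
    apply: hausdorff_mono => x [Sx tx]; split=> //=.
    rewrite (le_trans (level_radius t0 Sx tx))//.
    rewrite ge0_ler_powR ?nnegrE ?invr_ge0 ?divr_ge0 ?(ltW q0) ?(ltW M0) ?(ltW t0)//.
    by rewrite ler_pdivrMr// ler_peMr// ltW.
  rewrite (le_trans (HK _ r10))// lee_fin -mulrA ler_peMr//.
    by rewrite mulr_ge0// exprn_ge0// addr_ge0// ltW.
  by rewrite powRN powR_mulrn ?(ltW t0)// ler_pdivlMr ?exprn_gt0// mul1r lerXn2r ?nnegrE ?(ltW t0)// (le_trans (ltW t0)).
rewrite (_ : [set x | _] = set0) ?hausdorff_set0//.
  by rewrite lee_fin !mulr_ge0 ?exprn_ge0 ?mulr_ge0 ?powR_ge0 ?(ltW M0)// addr_ge0// ltW.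
apply/seteqP; split=> // x [Sx tx]; have rx := Sr _ Sx.
have nx : 0 < `|x| by exact: lt_le_trans rx.
have : T < M * powR `|x| (- q).
  by rewrite (lt_trans Tt)// (lt_le_trans tx)// Theta_le// -normr_gt0.
rewrite ltr_pM2l// !powRN ltf_pV2 ?posrE ?powR_gt0// ltNge ge0_ler_powR// ?nnegrE; exact: ltW.
Qed.

(** High levels live near 0, where the measure is at most [K' * rho t ^+ k], of order
    [t ^ (- k / q)]; this is integrable at infinity because [q < k]. *)
Lemma haus_wint_lty_near K K' : k%:R > q -> 0 <= K -> 0 <= K' ->
  (forall r, 0 < r ->
    (hausdorff k (S `&` [set x | (`|x| <= r)%R]) <= (K * (r + 1) ^+ d)%:E)%E) ->
  (forall r, 0 < r ->
    (hausdorff k (S `&` [set x | (`|x| <= r)%R]) <= (K' * r ^+ k)%:E)%E) ->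
  (haus_wint k Theta S < +oo)%E.
Proof.
move=> kq K0 K'0 HK HK'.
apply: (@haus_wint_lty K (K' * powR M (k%:R / q)) (k%:R / q)) => //.
- by rewrite mulr_ge0 ?powR_ge0.
- by rewrite ltr_pdivlMr// mul1r.
move=> t t1; have t0 : 0 < t by exact: lt_le_trans t1.
have r0 : 0 < rho t by rewrite powR_gt0// divr_gt0// (lt_le_trans _ M1).
apply: le_trans (hausdorff_mono _ _) (le_trans (HK' _ r0) _).
  by move=> x [Sx tx]; split=> //=; exact: level_radius.
by rewrite lee_fin rho_exprn// mulrA.
Qed.

End Finite.

(** * Infinite integrals, from balls along a ray *)

Section Infinite.
Variables (S : set 'rV[R]_n) (Theta : 'rV[R]_n -> R) (q d m s0 : R) (x0 : 'rV[R]_n).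
Hypotheses (n0 : (0 < n)%N) (d0 : 0 < d) (m0 : 0 < m) (s00 : 0 < s0).
Hypothesis Theta_ge : forall s v, 0 < s -> `|v - s *: x0| <= s * d ->
  m * powR s (- q) <= Theta v.

(** The scale [s] with [s ^ n = m / (2 * t)]. If [s ^ q <= s ^ n], the weight is at least
    [m / s ^ q >= 2 * t] on the ball of radius [s * d] about [s *: x0]. *)
Let root t := powR (m / (2 * t)) n%:R^-1.

(** Chosen so that the lower bound for the measure of the ball of radius [root t * d] is exactly
    [c / t]. *)
Let c := haus_const R n * (d ^+ n / (2 * 3 ^+ n)) * (m / 2).

Let c_gt0 : 0 < c.
Proof.
by rewrite /c mulr_gt0 ?divr_gt0// mulr_gt0 ?haus_const_gt0// divr_gt0 ?exprn_gt0// mulr_gt0 ?exprn_gt0.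
Qed.

Lemma root_gt0 t : 0 < t -> 0 < root t.
Proof. by move=> t0; rewrite powR_gt0// divr_gt0// mulr_gt0. Qed.

Lemma root_exprn t : 0 < t -> root t ^+ n = m / (2 * t).
Proof. by move=> t0; rewrite powR_root// ltW// divr_gt0// mulr_gt0. Qed.

Lemma level_ge t : 0 < t -> (forall v, `|v - root t *: x0| <= root t * d -> S v) ->
  powR (root t) q <= root t ^+ n ->
  ((c / t)%:E <= hausdorff n [set x | S x /\ (t < Theta x)%R])%E.
Proof.
move=> t0 Sv sq; have s0' := root_gt0 t0.
have -> : c / t = haus_const R n * ((root t * d) ^+ n / (2 * 3 ^+ n)).
  rewrite exprMn root_exprn// /c; by field; rewrite (gt_eqF t0) expf_neq0.
apply: (hausdorff_ball_ge (x := root t *: x0)) => //; first by rewrite mulr_gt0.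
move=> v vx; split; first exact: Sv.
apply: lt_le_trans (Theta_ge s0' vx); rewrite powRN ltr_pdivlMr ?powR_gt0//.
rewrite (@le_lt_trans _ _ (t * (root t ^+ n)))// ?ler_pM2l// root_exprn//.
rewrite (_ : t * _ = m / 2); last by field; rewrite gt_eqF.
  by rewrite ltr_pdivrMr// mulr_natr mulr2n ltrDl.
by rewrite divr_gt0// mulr_gt0.
Qed.

(** Small [t] correspond to large scales; at scales at least 1, [q <= n] gives [s ^ q <= s ^ n], and
    the integral diverges at 0. *)
Lemma haus_wint_pinfty_far : q <= n%:R ->
  (forall s v, s0 <= s -> `|v - s *: x0| <= s * d -> S v) ->
  haus_wint n Theta S = +oo%E.
Proof.
move=> qn HS; pose s1 := Num.max s0 1.
have s10 : 0 < s1 by rewrite lt_max s00.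
apply: (@integral_pinfty_head _ _ c (m / (2 * s1 ^+ n))) => //.
- by rewrite divr_gt0// mulr_gt0// exprn_gt0.
- by move=> *; exact: hausdorff_ge0.
move=> t /andP[t0 tT].
have : s1 <= root t.
  rewrite -(ler_pXn2r n0) ?nnegrE ?(ltW s10) ?(ltW (root_gt0 t0))// root_exprn//.
  rewrite ler_pdivlMr ?mulr_gt0//; move: tT; rewrite ler_pdivlMr ?mulr_gt0 ?exprn_gt0//.
  by rewrite mulrCA; lra.
rewrite ge_max => /andP[s0t t1]; apply: level_ge => //; first by move=> v; exact: HS.
by rewrite -powR_mulrn ?ler_powR// ltW// root_gt0.
Qed.

(** Large [t] correspond to small scales; at scales at most 1, [n <= q] gives [s ^ q <= s ^ n], and
    the integral diverges at infinity. *)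
Lemma haus_wint_pinfty_near : n%:R <= q ->
  (forall s v, 0 < s <= s0 -> `|v - s *: x0| <= s * d -> S v) ->
  haus_wint n Theta S = +oo%E.
Proof.
move=> qn HS; pose s1 := Num.min s0 1.
have s10 : 0 < s1 by rewrite lt_min s00 ltr01.
have T0 : 0 < m / (2 * s1 ^+ n) by rewrite divr_gt0// mulr_gt0// exprn_gt0.
apply: (@integral_pinfty_tail _ _ c (m / (2 * s1 ^+ n))) => //.
- by move=> *; exact: hausdorff_ge0.
move=> t tT; have t0 : 0 < t by exact: lt_le_trans tT.
have rt := root_gt0 t0.
have : root t <= s1.
  rewrite -(ler_pXn2r n0) ?nnegrE ?(ltW s10) ?(ltW rt)// root_exprn//.
  rewrite ler_pdivrMr ?mulr_gt0//; move: tT; rewrite ler_pdivrMr ?mulr_gt0 ?exprn_gt0//.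
  by rewrite mulrCA; lra.
rewrite le_min => /andP[s0t t1]; apply: level_ge => //.
  by move=> v; apply: HS; rewrite rt.
by rewrite -powR_mulrn ?ger_powR ?rt// ltW.
Qed.

End Infinite.
End Weights.

(** * Effective boundaries and differences of translates *)

Section ConeDifferences.
Context {R : realType} {n : nat}.
Implicit Types (C E A B : set 'rV[R]_n) (x y v w z : 'rV[R]_n).

Lemma translateE z B x : translate z B x <-> B (x - z).
Proof.
split=> [[y By <-]|Bx]; first by rewrite addrAC subrr add0r.
by exists (x - z) => //; rewrite addrC subrK.
Qed.

Lemma translate0 B : translate 0 B = B.
Proof. by apply/seteqP; split=> x; rewrite translateE subr0. Qed.

(** If [x - y] were interior to [C], points outside [E] close to [x] would lie in [y + C], which is
    contained in [E]. *)
Lemma eff_bd_slope C E x y : pointed_cone C -> pseudo_cone C E ->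
  eff_bd C E x -> eff_bd C E y -> ~ interior C (x - y).
Proof.
move=> hC hE [_ clx] [Ey _] /interior_normP[e e0 eC].
have [v [Cv Ev] vx] := closure_normP clx e0; apply: Ev.
rewrite -(subrK y v) addrC; apply: pseudo_cone_add hE Ey _.
by apply: eC; rewrite opprB addrA subrK.
Qed.

(** Otherwise [x - z] would be [w] plus two elements of [C], hence in [B]. *)
Lemma cone_difference_slope C B w z : pointed_cone C -> (forall c, C c -> B (w + c)) ->
  forall x y, (translate z C `\` translate z B) x -> (translate z C `\` translate z B) y ->
  ~ C (x - y - w).
Proof.
move=> [_ _ CD _ _] wB x y [_ Bx] [/translateE Cy _] Cxy; apply: Bx; apply/translateE.
have -> : x - z = w + ((y - z) + (x - y - w)).
  by apply/rowP => i; rewrite !mxE; ring.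
by apply: wB; exact: CD.
Qed.

Lemma cone_translate_sub C z : pointed_cone C -> C z -> translate z C `<=` C.
Proof. by move=> [_ _ CD _ _] Cz _ [y Cy <-]; exact: CD. Qed.

End ConeDifferences.

(** * The four ranges of the exponent *)

Theorem theorem1p2 (R : realType) (n : nat) (C E A : set 'rV[R]_n)
  (q : R) (Theta : 'rV[R]_n -> R) (z : 'rV[R]_n) :
  (2 <= n)%N -> pointed_cone C -> admissible_weight C q Theta ->
  pseudo_cone C E -> asymptotic_set C A -> (C `\ 0) z ->
  [/\ n%:R < q ->
        [/\ (wsurf Theta C E < +oo)%E, (wvol Theta E < +oo)%E,
            wcovol Theta C E = +oo%E, asym_covol Theta C A 0 = +oo%E &
            (asym_covol Theta C A z < +oo)%E],
      q = n%:R ->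
        [/\ (wsurf Theta C E < +oo)%E, wvol Theta E = +oo%E,
            wcovol Theta C E = +oo%E, asym_covol Theta C A 0 = +oo%E &
            (asym_covol Theta C A z < +oo)%E],
      (n.-1%:R < q < n%:R) ->
        [/\ (wsurf Theta C E < +oo)%E, wvol Theta E = +oo%E,
            (wcovol Theta C E < +oo)%E, (asym_covol Theta C A 0 < +oo)%E &
            (asym_covol Theta C A z < +oo)%E] &
      (0 <= q <= n.-1%:R) -> wvol Theta E = +oo%E].
Proof.
move=> n2 hC hT hE hA [Cz z0].
have n0 : (0 < n)%N by exact: ltn_trans n2.
have n10 : (0 < n.-1)%N by case: (n) n2 => [|[]].
have nn : n.-1%:R < n%:R :> R by rewrite ltr_nat prednK.
have [C0 Cs CD cvC [clC pC _]] := hC.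
have [M M1 TM] := weight_upper hC hT.
have [x0 [d [m [d0 m0 Tm]]]] := weight_lower n0 hC hT.
have EC := pseudo_cone_sub hE.
have [[a Ea] clE _ E0 _] := hE.
have [_ clA _ _ [_ A0 _]] := hA.
have [w Cw wA] := asymptotic_translate hC hA.
have [rE rE0 rEP] := closed_avoid0 clE E0.
have [rA rA0 rAP] := closed_avoid0 clA A0.
have aE c : C c -> E (a + c) by move=> Cc; exact: pseudo_cone_add hE Ea Cc.
have C0E : C `\` E = translate 0 C `\` translate 0 E by rewrite !translate0.
have surf : n.-1%:R < q -> (wsurf Theta C E < +oo)%E.
  move=> nq; have q0 : 0 < q by exact: le_lt_trans nq.
  have [K K0 HK] := hausdorff_cone_boundary n0 hC (fun x y => @eff_bd_slope _ _ C E x y hC hE).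
  apply: (haus_wint_lty_far (d := n.-1) M1 q0 nq _ n10 K0 rE0).
  - by move=> x [Ex _] x0n; apply: TM => //; exact: EC.
  - by move=> x [Ex _]; exact: rEP.
  - move=> r r0; apply: (le_trans (HK _ r0)); rewrite lee_fin ler_wpM2l// lerXn2r ?nnegrE; lra.
have vol : n%:R < q -> (wvol Theta E < +oo)%E.
  move=> nq; have q0 : 0 < q by exact: le_lt_trans nq.
  have [K K0 HK] := hausdorff_bounded E.
  apply: (haus_wint_lty_far (d := n) M1 q0 nq _ n0 K0 rE0).
  - by move=> x Ex x0n; apply: TM => //; exact: EC.
  - by move=> x Ex; exact: rEP.
  - move=> r r0; apply: (le_trans (HK _ r0)); rewrite lee_fin ler_wpM2l// lerXn2r ?nnegrE; lra.
have asz : n.-1%:R < q -> (asym_covol Theta C A z < +oo)%E.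
  move=> nq; have q0 : 0 < q by exact: le_lt_trans nq.
  (* This keeps [z + C] at distance at least [k * |z|] from 0. *)
  have [k k0 kC] := cone_norm_add hC.
  have nz : 0 < `|z| by rewrite normr_gt0; exact/eqP.
  have [K K0 HK] := hausdorff_cone_slab n0 hC (cone_difference_slope (z := z) hC wA).
  apply: (haus_wint_lty_far (d := n.-1) M1 q0 nq _ n0 K0 (mulr_gt0 k0 nz)) => //.
  - by move=> x [Cx _] x0n; apply: TM => //; exact: cone_translate_sub Cx.
  - by move=> x [[c Cc <-] _]; exact: kC.
(* Serves for [E] with apex [a] and for [A] with apex [w]. The difference may reach 0, where the
   bound of order [r ^ n] and [q < n] take over. *)
have near (B : set 'rV[R]_n) v : (forall c, C c -> B (v + c)) -> n.-1%:R < q < n%:R ->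
    (haus_wint n Theta (C `\` B) < +oo)%E.
  move=> vB /andP[nq qn]; have q0 : 0 < q by exact: le_lt_trans nq.
  have := cone_difference_slope (z := 0) hC vB; rewrite !translate0.
  move=> /(hausdorff_cone_slab n0 hC)[K K0 HK].
  have [K' K'0 HK'] := hausdorff_bounded (C `\` B).
  apply: (haus_wint_lty_near (d := n.-1) M1 q0 nq _ qn K0 K'0) => //.
  by move=> x [Cx _] x0n; exact: TM.
have volE : q <= n%:R -> wvol Theta E = +oo%E.
  (* Once [s * d / 2 >= |a|], the ball of radius [s * d / 2] about [s *: x0] lies in [a + C], hence
     in [E]. *)
  move=> qn; pose s0 := Num.max 1 (2 * `|a| / d).
  have s00 : 0 < s0 by rewrite lt_max ltr01.
  have d20 : 0 < d / 2 by rewrite divr_gt0.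
  have dd s v : 0 < s -> `|v - s *: x0| <= s * (d / 2) -> `|v - s *: x0| <= s * d.
    by move=> s0' /le_trans; apply; rewrite ler_pM2l//; lra.
  apply: (haus_wint_pinfty_far n0 d20 m0 s00 _ qn) => [s v s0' /dd/Tm|s v].
    by move=> /(_ s0' s0')[].
  rewrite ge_max => /andP[s1 sa] vs; have sp : 0 < s by exact: lt_le_trans s1.
  rewrite -(subrK a v) addrC; apply: aE; apply: (Tm _ _ sp _).1.
  rewrite addrAC (le_trans (ler_normB _ _))//.
  move: sa; rewrite ler_pdivrMr//; move: vs; lra.
have covE (B : set 'rV[R]_n) r : 0 < r -> (forall x, B x -> r <= `|x|) -> n%:R <= q ->
    haus_wint n Theta (C `\` B) = +oo%E.
  (* For [s <= s0] the points of the ball have norm at most [r / 2], so they miss [B]. *)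
  move=> r0 rB nq; pose s0 := r / (2 * (`|x0| + d)).
  have xd : 0 < `|x0| + d by rewrite ltr_wpDl.
  have s00 : 0 < s0 by rewrite divr_gt0// mulr_gt0.
  apply: (haus_wint_pinfty_near n0 d0 m0 s00 _ nq) => [s v sp /(Tm _ _ sp)[]//|s v /andP[sp ss] vs].
  split; first exact: (Tm _ _ sp vs).1.
  move=> /rB; apply/negP; rewrite -ltNge.
  have := ler_normD (v - s *: x0) (s *: x0); rewrite subrK normrZ (gtr0_norm sp).
  move: ss; rewrite ler_pdivlMr ?mulr_gt0//; move: vs; lra.
have cov : n%:R <= q -> wcovol Theta C E = +oo%E by exact: covE rE0 rEP.
have as0 : n%:R <= q -> asym_covol Theta C A 0 = +oo%E.
  by rewrite /asym_covol !translate0; exact: covE rA0 rAP.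
split.
- move=> nq; have nq' := lt_trans nn nq.
  by split; [exact: surf|exact: vol|exact/cov/ltW|exact/as0/ltW|exact: asz].
- move=> qn; have nq : n.-1%:R < q by rewrite qn.
  by split; [exact: surf|apply: volE|apply: cov|apply: as0|exact: asz]; rewrite qn.
- move=> nqn; have /andP[nq qn] := nqn.
  split; [exact: surf|exact/volE/ltW| |rewrite /asym_covol !translate0|exact: asz].
  + exact: near aE nqn.
  + exact: near wA nqn.
- by move=> /andP[_ qn]; apply: volE; rewrite (le_trans qn)// ltW.
Qed.
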